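(* For every natural number $d\geq 2$ there exists a minimal subshift $(X,S)$ with non-superlinear complexity that has $d$ distinct ergodic measures $\mu_0,\ldots,\mu_{d-1}$ whose partial rigidity rates are distinct and satisfy $0<\delta_{\mu_0}<\cdots<\delta_{\mu_{d-1}}<1$. Moreover, the partial rigidity sequence associated to each $\delta_{\mu_i}$ is the same for all $i$: there is a single increasing sequence of integers $(n_k)_{k\in\mathbb N}$ such that for every $i\in\{0,\ldots,d-1\}$ and every measurable set $A\subseteq X$, $\liminf_{k\to\infty}\mu_i(A\cap S^{-n_k}A)\geq \delta_{\mu_i}\,\mu_i(A)$.
   Context: A subshift $(X,S)$ is a closed $S$-invariant subset $X\subseteq A^{\mathbb Z}$ ($A$ a finite alphabet) with the shift map $S((x_n)_{n\in\mathbb Z})=(x_{n+1})_{n\in\mathbb Z}$; it is minimal if every orbit is dense. Ergodic measures are ergodic $S$-invariant Borel probability measures on $X$. Complexity: $p_X(n)$ is the number of words of length $n$ occurring in elements of $X$. $X$ has superlinear complexity if $\liminf_{n\to\infty}p_X(n)/n=\infty$, and non-superlinear complexity otherwise. Partial rigidity: a measure preserving system $(X,\mathcal X,\mu,T)$ is partially rigid if there exist $\delta>0$ and an increasing sequence of integers $(n_k)_{k\in\mathbb N}$ such that $\liminf_{k\to\infty}\mu(A\cap T^{-n_k}A)\geq\delta\mu(A)$ for every measurable $A$; then $\delta$ is called a constant of partial rigidity and $(n_k)$ a partial rigidity sequence. The partial rigidity rate $\delta_\mu$ is the supremum of all $\delta>0$ that are constants of partial rigidity for some sequence $(n_k)$,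 with $\delta_\mu=0$ if the system is not partially rigid. *)

(* Defs.v *)
From HB Require Import structures.
From mathcomp Require Import all_boot all_order all_algebra.
From mathcomp Require Import all_classical all_reals all_analysis.

Set Implicit Arguments.
Unset Strict Implicit.
Unset Printing Implicit Defensive.

Import Order.TTheory GRing.Theory Num.Theory.
Import numFieldNormedType.Exports.

Local Open Scope classical_set_scope.
Local Open Scope ring_scope.

(* The product topology, each factor A being discrete. *)
Definition full_shift (A : finType) : Type :=
  {ptws int -> discrete_topology A}.

HB.instance Definition _ (A : finType) := Topological.on (full_shift A).

Definition shift (A : finType) (x : full_shift A) : full_shift A :=
  fun n => x (n + 1).

(* Subshifts are non-empty, which the library's measurable types require. *)
Record subshift (A : finType) := Subshift {
  carrier :> set (full_shift A);
  subshift_closed : closed carrier;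
  subshift_invariant : @shift A @` carrier = carrier;
  subshift_nonempty : carrier !=set0 }.

(* The space X itself, with the topology induced by the full shift. *)
Definition subshift_space (A : finType) (X : subshift A) : Type := set_type X.

HB.instance Definition _ (A : finType) (X : subshift A) :=
  Topological.copy (subshift_space X) (set_type X).

Definition subshift_point (A : finType) (X : subshift A) : subshift_space X :=
  let x := cid (subshift_nonempty X) in exist _ (projT1 x) (mem_set (projT2 x)).

HB.instance Definition _ (A : finType) (X : subshift A) :=
  isPointed.Build (subshift_space X) (subshift_point X).

Notation borel X := (g_sigma_algebraType (@open (subshift_space X))).

Lemma carrier_shift (A : finType) (X : subshift A) (x : full_shift A) :
  carrier X x -> carrier X (shift x).
Proof. by move=> Xx; rewrite -(subshift_invariant X); exists x. Qed.

Definition subshift_map (A : finType) (X : subshift A) (x : subshift_space X) :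
  subshift_space X :=
  exist _ (shift (set_val x)) (mem_set (carrier_shift (set_mem (valP x)))).

(* The two-sided orbit {f^n x : n in Z} of a point under a bijection f; the
   negative iterates are those y with f^n y = x for some n >= 0. *)
Definition two_sided_orbit (T : Type) (f : T -> T) (x : T) : set T :=
  [set y | exists n : nat, y = iter n f x \/ iter n f y = x].

Definition minimal (T : topologicalType) (f : T -> T) : Prop :=
  forall x : T, dense (two_sided_orbit f x).

Definition occurs (A : finType) (n : nat) (w : n.-tuple A) (x : full_shift A) :
  Prop :=
  exists i : int, forall j : 'I_n, x (i + j%:Z) = tnth w j.

Definition complexity (A : finType) (X : subshift A) (n : nat) : nat :=
  #|[set w : n.-tuple A | `[< exists2 x, carrier X x & occurs w x >]]%SET|.

Definition superlinear_complexity (R : realType) (A : finType)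
    (X : subshift A) : Prop :=
  limn_einf (fun n => ((complexity X n)%:R / n%:R : R)%:E) = +oo%E.

Definition measure_preserving (R : realType) (d : measure_display)
    (T : measurableType d) (mu : probability T R) (f : T -> T) : Prop :=
  measurable_fun setT f /\
  forall B : set T, measurable B -> mu (f @^-1` B) = mu B.

Definition ergodic (R : realType) (d : measure_display)
    (T : measurableType d) (mu : probability T R) (f : T -> T) : Prop :=
  measure_preserving mu f /\
  forall B : set T, measurable B -> f @^-1` B = B ->
    mu B = 0%E \/ mu B = 1%E.

Definition partially_rigid_along (R : realType) (d : measure_display)
    (T : measurableType d) (mu : probability T R) (f : T -> T)
    (delta : R) (n : nat -> nat) : Prop :=
  {homo n : k l / (k < l)%N >-> (k < l)%N} /\
  forall B : set T, measurable B ->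
    (delta%:E * mu B <=
       limn_einf (fun k => mu (B `&` iter (n k) f @^-1` B)))%E.

(* [sup set0 = 0] gives the rate 0 to systems that are not partially rigid;
   taking B := setT shows that the set is bounded above by 1. *)
Definition partial_rigidity_rate (R : realType) (d : measure_display)
    (T : measurableType d) (mu : probability T R) (f : T -> T) : R :=
  sup [set delta : R |
    0 < delta /\ exists n : nat -> nat, partially_rigid_along mu f delta n].

(* Main.v *)
(* Letters are states (type, label) in I_d x Z/4. The level-(k+1) block with
   state b = (i, l) is a concatenation of q_k = 8^len(k) level-k blocks of
   the same height h_k. Apart from rare positions, where the type changes,
   these have type i and labels l + psi(t_1) + psi(t_2) + ..., where the t_j
   are the base-8 digits of the position that are left after dropping the i+1
   lowest ones. Each level-k block is thus repeated L_i = 8^(i+1) times in a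
   row, so a shift by h_k fixes all but about 1/L_i of the blocks.
   Conversely, a nontrivial shift of the digit pattern psi agrees with it on
   at most half of the positions, and blocks with different states differ
   everywhere; a large lag is h_k m with q_k not dividing m, and it matches
   x_0 with x_lag with frequency at most 1 - 1/L_i + o(1). Summing the return
   masses over the letters turns this into the upper bound 1 - 1/L_i for the
   rate.

   The positions where the type changes have summable density, so the
   frequencies inside the blocks of type i converge to an invariant measure
   mu_i, independently of the label because the labels are equidistributed in
   every block; this independence also gives ergodicity. On the other hand
   every level-k block occurs in every level-(k+1) block, which makes the
   subshift minimal. There are 4d blocks of each level, whence p(h_k) <=
   (4d)^2 h_k. *)

Require Import Defs.
From HB Require Import structures.
From mathcomp Require Import all_boot all_order all_algebra.
From mathcomp Require Import all_classical all_reals all_analysis.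
From mathcomp Require Import zify lra ring.

Set Implicit Arguments.
Unset Strict Implicit.
Unset Printing Implicit Defensive.

Import Order.TTheory GRing.Theory Num.Theory.
Import numFieldNormedType.Exports.

Local Open Scope nat_scope.

(** The rates must come out exactly, so the upper bound 1 - 1/L, where L = L_i, has to hold for
    every lag. The half bound alone does not give it: for a lag L m + r in units of blocks, the
    positions of a run split into L - r that see the lag m and r that see m + 1 in the collapsed
    pattern, and it may be that only one position in L sees a lag that the half bound covers. This
    loses 1/(2L), less than the required 1/L. Hence a second estimate, proved by induction over the
    levels: any nonzero lag up to half the period loses at least 3/(4L). The sum 1/2 + 3/4 exceeds
    1, and the surplus pays for the changes of type. For lags shorter than a run the bound must
    nearly equal the lower bound. There it matters that consecutive entries of the table differ and
    that its last entry equals its first: a step by one then changes the label either at the lowest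
    digit or, after a carry, at a higher one, and agreement survives only when all digits carry. *)

Lemma big_ord_mul (V : Type) (idx : V) (op : Monoid.law idx) (M N : nat)
    (g : nat -> V) :
  \big[op/idx]_(x < M * N) g x =
  \big[op/idx]_(z < M) \big[op/idx]_(x < N) g (z * N + x)%N.
Proof.
elim: M => [|M IH]; first by rewrite !big_ord0.
by rewrite big_ord_recr /= -IH mulSnr big_split_ord.
Qed.

Lemma sum_ord_mul (M N : nat) (f : nat -> nat) :
  \sum_(x < M * N) f x = \sum_(z < M) \sum_(x < N) f (z * N + x).
Proof. exact: big_ord_mul. Qed.

Lemma sum_ord_split (N r : nat) (f : nat -> nat) : r <= N ->
  \sum_(x < N) f x = \sum_(x < N - r) f x + \sum_(x < r) f (N - r + x).
Proof.
move=> rN; have [a ->] : exists a, N = a + r by exists (N - r); rewrite subnK.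
by rewrite addnK big_split_ord.
Qed.

Lemma sum_ord_const N c : \sum_(x < N) c = N * c.
Proof. by rewrite sum_nat_const card_ord. Qed.

(* A table whose shifts agree with at most half of its entries, up to one
   additive constant before and one after the wrap-around. *)
Definition psi_table : seq nat := [:: 0; 1; 2; 3; 1; 3; 2; 0].

Definition psi (x : nat) : 'Z_4 := inZp (nth 0 psi_table x).

Lemma psi0 : psi 0 = 0%R. Proof. exact/val_inj. Qed.

Lemma psi7 : psi 7 = 0%R. Proof. exact/val_inj. Qed.

Lemma Z4_ind (P : 'Z_4 -> Prop) :
  (forall m, m < 4 -> P (inZp m)) -> forall c, P c.
Proof. by move=> Pm c; rewrite -[c]valZpK; apply: Pm. Qed.

Lemma psi_succ_neq x : x < 7 -> (psi x == psi x.+1) = false.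
Proof. by do 7![case: x => [//|x]]. Qed.

(** The table takes each of the four values exactly twice. *)
Lemma sum_psi (g : 'Z_4 -> nat) (c : 'Z_4) :
  \sum_(x < 8) g (c + psi x)%R = 2 * \sum_(l : 'Z_4) g l.
Proof.
rewrite (reindex_inj (addrI c)) /=.
rewrite (eq_bigr (fun l : 'I_4 => g (c + inZp l)%R)); last first.
  by move=> l _; rewrite valZpK.
rewrite !big_ord_recl !big_ord0 /psi /= /bump /= !addn0 !add1n; lia.
Qed.

Lemma psi_surj (c : 'Z_4) : exists2 x, x < 8 & psi x = c.
Proof.
elim/Z4_ind: c; case=> [|[|[|[|//]]]] _;
  by [exists 0|exists 1|exists 2|exists 3].
Qed.

Lemma psi_match r (c c' : 'Z_4) : 0 < r < 8 ->
  \sum_(x < 8)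
    (psi x == (psi ((x + r) %% 8)%N + if (x + r < 8)%N then c else c')%R) <= 4.
Proof.
move: c c'; elim/Z4_ind => m m4; elim/Z4_ind => m' m'4.
case: m m4 => [|[|[|[|//]]]] _; case: m' m'4 => [|[|[|[|//]]]] _;
case: r => [|[|[|[|[|[|[|[|//]]]]]]]] // _;
by rewrite !big_ord_recl !big_ord0; vm_compute.
Qed.

Fixpoint digit_sum n x : 'Z_4 :=
  if n is n'.+1 then (psi (x %% 8)%N + digit_sum n' (x %/ 8)%N)%R else 0%R.

Lemma digit_sum_mod n x y : digit_sum n (x + y * 8 ^ n) = digit_sum n x.
Proof.
elim: n x => [//|n IH] x /=; rewrite expnSr mulnA.
by rewrite addnC modnMDl divnMDl // addnC IH.
Qed.

Definition stack n (f : nat -> 'Z_4) z : 'Z_4 :=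
  (digit_sum n z + f (z %/ 8 ^ n)%N)%R.

Lemma stackS n f z : stack n.+1 f z = (psi (z %% 8)%N + stack n f (z %/ 8)%N)%R.
Proof. by rewrite /stack /= addrA expnS divnMA. Qed.

(** * Agreement of digit patterns with their shifts *)

Definition matches (f : nat -> 'Z_4) m N := \sum_(x < N) (f x == f (x + m)).

Lemma matches_mul f m M N : matches f m (M * N) =
  \sum_(z < M) \sum_(x < N) (f (z * N + x) == f (z * N + x + m)).
Proof. exact: (sum_ord_mul M N (fun x => f x == f (x + m))). Qed.

(** By induction on the digits: a lag divisible by 8 fixes the lowest digit and acts on the higher
    ones; any other lag rotates the lowest digit, and then [psi_match] bounds every aligned window
    of 8 positions by itself. *)
Lemma stack_matches_half n f m N : ~~ (8 ^ n %| m) ->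
  matches (stack n f) m (8 ^ n * N) * 2 <= 8 ^ n * N.
Proof.
elim: n m => [|n IH] m; first by rewrite dvd1n.
move=> ndv; rewrite expnS -mulnA [8 * _]mulnC matches_mul.
have [r0|r_neq0] := eqVneq (m %% 8) 0.
  have Em : m = m %/ 8 * 8 by rewrite {1}(divn_eq m 8) r0 addn0.
  move: (m %/ 8) Em ndv => m' {r0}-> ndv.
  rewrite (eq_bigr (fun z : 'I_(8 ^ n * N) =>
      (stack n f z == stack n f (z + m')) * 8)); last first.
    move=> z _; rewrite [RHS]mulnC -[RHS]sum_ord_const.
    apply: eq_bigr => x _; rewrite !stackS addnAC -mulnDl !divnMDl // !modnMDl.
    by rewrite divn_small // !addn0 (inj_eq (addrI _)).
  rewrite -big_distrl /=.
  have ndv' : ~~ (8 ^ n %| m').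
    by apply: contra ndv => dv; rewrite expnSr dvdn_pmul2r.
  by rewrite mulnAC leq_pmul2r //; apply: IH.
set r := m %% 8.
have r_gt0 : 0 < r < 8 by rewrite lt0n r_neq0 ltn_mod.
rewrite -leq_divRL //.
suff H : forall z : nat,
  \sum_(x < 8) (stack n.+1 f (z * 8 + x) == stack n.+1 f (z * 8 + x + m)) <= 4.
  rewrite (_ : _ %/ 2 = 8 ^ n * N * 4);
    last by rewrite (_ : 8 = 4 * 2) // mulnA mulnK.
  by rewrite -[leqRHS]sum_ord_const; apply: leq_sum => z _; apply: H.
move=> z.
(* How the contribution of the higher digits changes without and with a carry; neither depends on
   the position inside the window. *)
pose c := (stack n f (z + m %/ 8)%N - stack n f z)%R.
pose c' := (stack n f (z + m %/ 8).+1%N - stack n f z)%R.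
apply: leq_trans (psi_match c c' r_gt0); apply: leq_sum => x _.
rewrite !stackS divnMDl // modnMDl divn_small // addn0 (@modn_small x) //.
have -> : (z * 8 + x + m) %% 8 =
  (x + r) %% 8 by rewrite -addnA modnMDl -modnDmr.
have -> : (z * 8 + x + m) %/ 8 = (z + m %/ 8) + (x + r) %/ 8.
  by rewrite {1}(divn_eq m 8) -/r addnACA -mulnDl divnMDl.
have E (a b u w : 'Z_4) : (a + u == b + w)%R = (a == b + (w - u))%R.
  by rewrite addrA eq_sym [RHS]eq_sym subr_eq.
rewrite E; have [xr|xr] := ltnP; first by rewrite (divn_small xr) addn0.
suff -> : (x + r) %/ 8 = 1 by rewrite addn1.
by have := ltn_ord x; have /andP[_] := r_gt0; lia.
Qed.

Lemma stack_matches_multiple n f m N :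
  matches (stack n f) (8 ^ n * m) (8 ^ n * N) = 8 ^ n * matches f m N.
Proof.
rewrite mulnC [8 ^ n * N]mulnC matches_mul [RHS]mulnC big_distrl.
apply: eq_bigr => z _; rewrite [RHS]mulnC -[RHS]sum_ord_const.
apply: eq_bigr => x _; congr (nat_of_bool _).
rewrite /stack addnAC -mulnDl ![_ * _ + x]addnC !digit_sum_mod.
rewrite (inj_eq (addrI _)) ![x + _]addnC !divnMDl ?expn_gt0 //.
by rewrite divn_small // !addn0.
Qed.

(** Inside a window of 8, consecutive table entries differ and nothing agrees. From digit 7 to digit
    0 the table contributes the same, so agreement is decided by the higher digits, again at lag
    1. *)
Lemma stack_matches_succ n f N : matches (stack n f) 1 (8 ^ n * N) <= N.
Proof.
elim: n => [|n IH].
  rewrite expn0 mul1n -[leqRHS]muln1 -[leqRHS]sum_ord_const.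
  by apply: leq_sum => x _; apply: leq_b1.
apply: leq_trans IH; rewrite expnS -mulnA [8 * _]mulnC matches_mul.
apply: leq_sum => z _; rewrite big_ord_recr /= big1 ?add0n.
  have -> : z * 8 + 7 + 1 = z.+1 * 8 by lia.
  rewrite !stackS modnMl mulnK // modnMDl divnMDl // modn_small // divn_small
    //.
  by rewrite addn0 psi0 psi7 (inj_eq (addrI _)) addn1.
move=> x _; rewrite !stackS -addnA !divnMDl // !modnMDl.
have x8 : x + 1 < 8 by have := ltn_ord x; lia.
rewrite (divn_small x8) (modn_small x8) divn_small ?modn_small; try lia.
by rewrite (inj_eq (addIr _)) addn1 psi_succ_neq.
Qed.

(** Of the [L] positions of a run, the last [r] are carried one run further than the others. *)
Lemma run_matches L (g : nat -> 'Z_4) m r N : r < L ->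
  matches (fun x => g (x %/ L)) (L * m + r) (L * N) =
  (L - r) * matches g m N + r * matches g m.+1 N.
Proof.
move=> rL; have L_gt0 : 0 < L by lia.
rewrite mulnC [L * N]mulnC matches_mul !big_distrr -big_split /=.
apply: eq_bigr => z _.
rewrite (sum_ord_split (fun x =>
  nat_of_bool (g ((z * L + x) %/ L) == g ((z * L + x + (m * L + r)) %/ L)))
  (ltnW rL)).
congr (_ + _).
  rewrite -[RHS]sum_ord_const; apply: eq_bigr => x _.
  have xL := ltn_ord x.
  rewrite addnACA -mulnDl !divnMDl // !divn_small ?addn0 //; lia.
rewrite -[RHS]sum_ord_const; apply: eq_bigr => x _.
have xL := ltn_ord x.
rewrite addnACA -mulnDl !divnMDl //.
have -> : (L - r + x + r) %/ L = 1.
  rewrite addnAC subnK ?(ltnW rL) // divnDl // divnn L_gt0 divn_small //; lia.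
by rewrite divn_small ?addn0 ?addn1 ?addnS //; lia.
Qed.

(** * The block words *)

Section BlockWords.
Variable D : nat.

Definition state : finType := ('I_D.+1 * 'Z_4)%type.

(** In the exponent, [2 * D.+1] covers the positions where the type changes, [k] makes their density
    summable over the levels, and [D.+1 + 3] keeps this density at most 1 / (512 run i) at every
    level. *)
Definition len k := 3 * D.+1 + k + 3.
Definition q k := 8 ^ len k.
Definition run (i : 'I_D.+1) := 8 ^ i.+1.

(* [Q k n] is the number of level-[k] blocks in a level-[k + n] block. *)
Fixpoint Q k n := if n is n'.+1 then q k * Q k.+1 n' else 1.
Definition h k := Q 0 k.

(* The shift is nonzero where the digits from rank [D.+2] on spell a number in
   [1, D].  The digit of rank [i.+1 < D.+2], the lowest one that acts on the
   label, is free there, so every label occurs together with every shift. *)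
Definition type_shift k x :=
  let u := (x %/ 8 ^ D.+2) %% 8 ^ (len k - D.+2) in if u <= D then u else 0.

(* For a fixed position [x] this is injective in [b], hence two blocks with
   different states have no common letter at the same place. *)
Definition substitution k (b : state) x : state :=
  ((b.1 + inord (type_shift k x))%R,
   (b.2 + digit_sum (len k - b.1.+1) (x %/ run b.1)%N)%R).

(* The state of the [x]-th level-[k] block inside the level-[k + n] block with
   state [b]. *)
Fixpoint descend k n b x : state :=
  if n is n'.+1 then substitution k (descend k.+1 n' b (x %/ q k)) x else b.

Definition block_word := descend 0.

Fixpoint keeps_type k n x :=
  if n is n'.+1 then (type_shift k x == 0) && keeps_type k.+1 n' (x %/ q k)
  else true.

(** What [descend] adds to the label as long as the type stays [i]. It ignores changes of type,
    which makes it exactly self-similar; the positions where it is wrong are counted by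
    [bad_count]. *)
Fixpoint label_pattern (i : 'I_D.+1) k n x : 'Z_4 :=
  if n is n'.+1 then
    (digit_sum (len k - i.+1) (x %/ run i)%N +
     label_pattern i k.+1 n' (x %/ q k)%N)%R
  else 0%R.

Lemma q_gt0 k : 0 < q k. Proof. by rewrite expn_gt0. Qed.

Lemma Q_gt0 k n : 0 < Q k n.
Proof. by elim: n k => //= n IH k; rewrite muln_gt0 q_gt0 IH. Qed.

Lemma QD k m n : Q k (m + n) = Q k m * Q (k + m) n.
Proof.
elim: m k => [|m IH] k /=; first by rewrite mul1n addn0.
by rewrite IH mulnA addSnnS.
Qed.

Lemma hS k : h k.+1 = h k * q k.
Proof. by rewrite /h -addn1 QD /= muln1. Qed.

Lemma hD k n : h (k + n) = h k * Q k n.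
Proof. exact: QD. Qed.

Lemma h_gt0 k : 0 < h k. Proof. exact: Q_gt0. Qed.

Lemma leq_8_q k : 8 <= q k.
Proof. by rewrite -[8]/(8 ^ 1) leq_exp2l // /len; lia. Qed.

Lemma leq_exp_h k : 8 ^ k <= h k.
Proof.
by elim: k => // k IH; rewrite hS expnSr leq_mul // leq_8_q.
Qed.

Lemma ltn_h k : k < h k.
Proof. by apply: leq_trans (leq_exp_h k); apply: ltn_expl. Qed.

Lemma len_split k : len k = D.+2 + (len k - D.+2).
Proof. by rewrite subnKC // /len; lia. Qed.

Lemma type_shift_mod k x y : type_shift k (x + q k * y) = type_shift k x.
Proof.
suff E : (x + q k * y) %/ 8 ^ D.+2 = y * 8 ^ (len k - D.+2) + x %/ 8 ^ D.+2.
  by rewrite /type_shift E modnMDl.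
rewrite /q {1}len_split expnD -mulnA [8 ^ D.+2 * _]mulnC addnC.
by rewrite divnMDl ?expn_gt0 // mulnC.
Qed.

Lemma substitution_mod k b x y : substitution k b (x + q k * y) =
  substitution k b x.
Proof.
have lb : b.1.+1 <= len k by have := ltn_ord b.1; rewrite /len; lia.
suff E : (x + q k * y) %/ run b.1 = x %/ run b.1 + y * 8 ^ (len k - b.1.+1).
  by rewrite /substitution type_shift_mod E digit_sum_mod.
rewrite /q -{1}(subnKC lb) expnD -mulnA [8 ^ b.1.+1 * _]mulnC addnC.
by rewrite divnMDl ?expn_gt0 // addnC mulnC.
Qed.

Lemma descend_mod k n b x y : descend k n b (x + Q k n * y) = descend k n b x.
Proof.
elim: n k b x y => // n IH k b x y /=.
rewrite -mulnA substitution_mod; congr substitution.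
by rewrite addnC mulnC divnMDl ?q_gt0 // addnC IH.
Qed.

Lemma descend_add k m n b x :
  descend k (m + n) b x = descend k m (descend (k + m) n b (x %/ Q k m)) x.
Proof.
elim: m k x => [|m IH] k x /=; first by rewrite divn1 addn0.
by rewrite IH divnMA addSnnS.
Qed.

Lemma descend_block k m n b P y : y < Q k m ->
  descend k (m + n) b (P * Q k m + y) = descend k m (descend (k + m) n b P) y.
Proof.
move=> yQ; rewrite descend_add divnMDl ?Q_gt0 // divn_small // addn0.
by rewrite [P * _ + y]addnC [P * _]mulnC descend_mod.
Qed.

Lemma block_word_block k n b P y : y < h k ->
  block_word (k + n) b (P * h k + y) = block_word k (descend k n b P) y.
Proof. by rewrite /block_word => yh; rewrite descend_block. Qed.

Lemma substitution_inj k x : injective (substitution k ^~ x).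
Proof.
move=> [i l] [i' l'] E; have /= /addIr Ei := congr1 fst E.
by move: E; rewrite -{}Ei => E; have /= /addIr-> := congr1 snd E.
Qed.

Lemma descend_inj k n x : injective (descend k n ^~ x).
Proof. by elim: n k x => [|n IH] k x b b' //= /substitution_inj; apply: IH. Qed.

Lemma keeps_type_descend k n i l x : keeps_type k n x ->
  descend k n (i, l) x = (i, (l + label_pattern i k n x)%R).
Proof.
elim: n k x => [|n IH] k x /=; first by rewrite addr0.
case/andP=> /eqP t0 /IH ->; rewrite /substitution t0 /=.
have -> : inord 0 = 0%R :> 'I_D.+1 by apply/val_inj; rewrite /= inordK.
by rewrite addr0 -addrA [(label_pattern _ _ _ _ + _)%R]addrC.
Qed.

Lemma keeps_type_mod k n x y : keeps_type k n (x + Q k n * y) =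
  keeps_type k n x.
Proof.
elim: n k x y => // n IH k x y /=.
by rewrite -mulnA type_shift_mod [x + _]addnC [q k * _]mulnC divnMDl ?q_gt0 //
  [_ * y + _]addnC IH.
Qed.

(** Only [D] values of the high digits change the type, each on [8 ^ D.+2] positions, and D is below
    8 ^ D. *)
Lemma type_shift_count k : \sum_(x < q k) (type_shift k x != 0) <=
  8 ^ (2 * D.+1).
Proof.
set N := 8 ^ (len k - D.+2).
have -> : q k = N * 8 ^ D.+2 by rewrite /q len_split expnD mulnC.
rewrite (sum_ord_mul _ _ (fun x => nat_of_bool (type_shift k x != 0))).
have H (z : 'I_N) :
  \sum_(x < 8 ^ D.+2) (type_shift k (z * 8 ^ D.+2 + x) != 0) <=
    (0 < z <= D) * 8 ^ D.+2.
  rewrite [leqRHS]mulnC -[leqRHS]sum_ord_const; apply: leq_sum => x _.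
  rewrite /type_shift divnMDl ?expn_gt0 // divn_small // addn0 modn_small //.
  by case: (_ <= D); rewrite ?andbT ?andbF // lt0n.
apply: leq_trans (leq_sum _ (fun z _ => H z)) _.
rewrite -big_distrl /=.
have DN : \sum_(z < N) (0 < z <= D) <= D.
  suff : \sum_(z < N) (0 < z <= D) <= minn D N.-1 by lia.
  elim: (N) => [|M IH]; first by rewrite big_ord0.
  by rewrite big_ord_recr /=; move: IH; set S := bigop _ _ _; lia.
have D8 : D * 8 ^ D.+2 <= 8 ^ (2 * D.+1).
  rewrite (_ : 2 * D.+1 = D + D.+2); last by lia.
  by rewrite expnD leq_mul // ltnW // ltn_expl.
by apply: leq_trans D8; rewrite leq_mul.
Qed.

(** Level [k] alone has density at most 1 / 8 ^ (D.+1 + k + 3) of type changes; the higher levels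
    add a geometric series of ratio 1/8, which the factor 2 absorbs. *)
Lemma bad_count k n :
  (\sum_(x < Q k n) ~~ keeps_type k n x) * 8 ^ (D.+1 + k + 3) <= 2 * Q k n.
Proof.
elim: n k => [|n IH] k; first by rewrite /= big1.
rewrite [Q k _]/= [q k * _]mulnC.
rewrite (sum_ord_mul _ _ (fun x => nat_of_bool (~~ keeps_type k n.+1 x))) mulnC.
have H (z : nat) : \sum_(x < q k) ~~ keeps_type k n.+1 (z * q k + x) <=
    8 ^ (2 * D.+1) + q k * ~~ keeps_type k.+1 n z.
  apply: leq_trans (leq_add (type_shift_count k) (leqnn _)).
  rewrite -[q k * _]sum_ord_const -big_split /=; apply: leq_sum => x _.
  rewrite [z * _ + x]addnC [z * _]mulnC type_shift_mod addnC [q k * _]mulnC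
    divnMDl ?q_gt0 //.
  by rewrite divn_small // addn0; case: (type_shift k x == 0); case: keeps_type.
set S := bigop _ _ _.
have : S <= \sum_(z < Q k.+1 n) (8 ^ (2 * D.+1) + q k * ~~ keeps_type k.+1 n z).
  by apply: leq_sum => z _; apply: H.
rewrite big_split /= sum_ord_const -big_distrr /=.
have := IH k.+1; set B := bigop _ _ _ => HB HS.
have Eq : q k = 8 ^ (2 * D.+1) * 8 ^ (D.+1 + k + 3).
  by rewrite -expnD /q /len; congr (8 ^ _); lia.
move: HB HS; rewrite {H}Eq.
have -> : D.+1 + k.+1 + 3 = (D.+1 + k + 3).+1 by lia.
rewrite expnS.
move: S (8 ^ (D.+1 + k + 3)) (8 ^ (2 * D.+1)) (Q k.+1 n) B => S E F N B HB HS.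
have : E * S <= E * (N * F + F * E * B) by rewrite leq_mul.
have HB' : 4 * (B * E) <= N by move: HB; rewrite mulnCA; lia.
have := leq_mul (leqnn (F * E)) HB'; lia.
Qed.

(** [keeps_type] has period [Q k n], so every window of that length gives the same count. *)
Lemma keeps_type_shift_count k n m :
  \sum_(x < Q k n) ~~ keeps_type k n (x + m) =
    \sum_(x < Q k n) ~~ keeps_type k n x.
Proof.
elim: m => [|m IH]; first by apply: eq_bigr => x _; rewrite addn0.
rewrite -{}IH; move: (Q_gt0 k n) (keeps_type_mod k n);
  move: (Q k n) => [//|N] _ gm.
rewrite big_ord_recr [RHS]big_ord_recl /= add0n addnC; congr (_ + _).
  by rewrite -(gm m 1) muln1 addnC addSnnS.
by apply: eq_bigr => x _; rewrite /= /bump leq0n add1n addSnnS.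
Qed.

End BlockWords.

(** * Agreement of a block with its shifts *)

Section MatchCounts.
Variable D : nat.
Implicit Types (i : 'I_D.+1).
Local Notation len := (len D).
Local Notation q := (q D).
Local Notation h := (h D).
Local Notation Q := (Q D).

Definition depth i k := len k - i.+1.

Lemma leq_8_run i : 8 <= run i.
Proof. by rewrite -[leqLHS]/(8 ^ 1) leq_exp2l. Qed.

Lemma leq_8_depth i k : 8 <= 8 ^ depth i k.
Proof.
rewrite -[leqLHS]/(8 ^ 1) leq_exp2l // /depth /len.
have := ltn_ord i; lia.
Qed.

Lemma q_depth i k : q k = run i * 8 ^ depth i k.
Proof.
rewrite -expnD /q /depth subnKC // /len; have := ltn_ord i; lia.
Qed.

(** The pattern of the next lemma with each run of equal labels collapsed to one position. *)
Definition mid i k n := stack (depth i k) (label_pattern i k.+1 n).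

Lemma label_patternE i k n x : label_pattern i k n.+1 x =
  mid i k n (x %/ run i).
Proof. by rewrite /mid /stack /= (q_depth i) divnMA. Qed.

Lemma eq_matches f g m N : f =1 g -> matches f m N = matches g m N.
Proof. by move=> fg; apply: eq_bigr => x _; rewrite !fg. Qed.

Lemma matches_le f m N : matches f m N <= N.
Proof.
rewrite -[leqRHS]muln1 -[leqRHS]sum_ord_const.
by apply: leq_sum => x _; apply: leq_b1.
Qed.

Lemma label_pattern_matches i k n m r : r < run i ->
  matches (label_pattern i k n.+1) (run i * m + r) (Q k n.+1) =
  (run i - r) * matches (mid i k n) m (8 ^ depth i k * Q k.+1 n) +
  r * matches (mid i k n) m.+1 (8 ^ depth i k * Q k.+1 n).
Proof.
move=> rL; rewrite (eq_matches _ _ (label_patternE i k n)) [Q k _]/= (q_depth i)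
  -mulnA.
exact: run_matches.
Qed.

(** Agreement at most 1 - 3 / (4 run i), with denominators cleared. The lag is kept within half the
    period because a full period agrees everywhere. *)
Definition label_pattern_bound i k n := forall m, 0 < m -> 2 * m <= Q k n ->
  matches (label_pattern i k n) m (Q k n) * (4 * run i) <=
    (4 * run i - 3) * Q k n.

(** The slack 2 admits the lag [m'.+1] that arises at the end of a run. It is smaller than
    [8 ^ depth i k], so it vanishes when a multiple of that number is divided by it. *)
Lemma mid_bound i k n m : label_pattern_bound i k.+1 n ->
  0 < m -> 2 * m <= 8 ^ depth i k * Q k.+1 n + 2 ->
  matches (mid i k n) m (8 ^ depth i k * Q k.+1 n) * (4 * run i) <=
  (4 * run i - 3) * (8 ^ depth i k * Q k.+1 n).
Proof.
move=> IH m0 mQ; have L8 := leq_8_run i; have P8 := leq_8_depth i k.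
have [dv|ndv] := boolP (8 ^ depth i k %| m).
  case/dvdnP: dv => m'; rewrite mulnC => Em; rewrite Em in m0 mQ *.
  rewrite /mid stack_matches_multiple -mulnA.
  rewrite [leqRHS]mulnCA leq_mul2l; apply/orP; right.
  apply: IH; first by move: m0; rewrite muln_gt0 => /andP[].
  move: mQ P8; move: (8 ^ depth i k) (Q k.+1 n) => P N mQ P8.
  have [//|lt_N] := leqP (2 * m') N; nia.
have := stack_matches_half (label_pattern i k.+1 n) (Q k.+1 n) ndv.
rewrite -/(mid i k n); move: (8 ^ _ * _) (matches _ _ _) => X A; nia.
Qed.

Lemma mid_succ i k n :
  matches (mid i k n) 1 (8 ^ depth i k * Q k.+1 n) <= Q k.+1 n.
Proof. exact: stack_matches_succ. Qed.

(** A lag shorter than a run loses nearly everything at the run ends, by [mid_succ]: at least 7 / (8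
    run i). Any other lag gives an average of two counts for [mid], and both have the bound by
    induction. *)
Lemma label_pattern_matches_bound i k n : label_pattern_bound i k n.
Proof.
elim: n k => [|n IH] k m m0 mQ; first by move: mQ m0 => /=; lia.
have L8 := leq_8_run i; have P8 := leq_8_depth i k.
have rL : m %% run i < run i by rewrite ltn_mod; lia.
have EQ : Q k n.+1 = run i * (8 ^ depth i k * Q k.+1 n).
  by rewrite [LHS]/= (q_depth i) mulnA.
rewrite {1}(divn_eq m (run i)) [leqLHS]mulnC [_ %/ _ * _]mulnC
  label_pattern_matches //.
have := divn_eq m (run i); move: (m %/ run i) (m %% run i) rL => m' r rL Em.
rewrite EQ in mQ *.
have [m'0|m'_gt0] := posnP m'.
  rewrite m'0 in Em *.
  have := mid_succ i k n.
  have := matches_le (mid i k n) 0 (8 ^ depth i k * Q k.+1 n).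
  move: (run i) (8 ^ depth i k) (Q k.+1 n) (matches _ 1 _) (matches _ 0 _) P8 L8
    rL.
  move=> L P N B A P8 L8 rL HA HB.
  have r1 : 1 <= r by lia.
  have : (L - r) * A + r * B <= (L - r) * (P * N) + r * N by rewrite leq_add
    ?leq_mul.
  have : 8 * (r * N) <= r * (P * N) by nia.
  have : P * N <= r * (P * N) by nia.
  have : (L - r) * (P * N) = L * (P * N) - r * (P * N) by rewrite mulnBl.
  have : r * (P * N) <= L * (P * N) by nia.
  nia.
have H1 := @mid_bound i k n m' (IH k.+1) m'_gt0.
have H2 := @mid_bound i k n m'.+1 (IH k.+1) isT.
move: H1 H2 mQ; move: (8 ^ _ * _) (matches _ m'.+1 _) (matches _ m' _) => X B A.
move: (run i) L8 rL Em => L L8 rL Em H1 H2 mQ.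
have m'X : 2 * m' <= X by nia.
have {}H1 := H1 (leq_trans m'X (leq_addr _ _)).
have {}H2 : B * (4 * L) <= (4 * L - 3) * X by apply: H2; lia.
have -> : 4 * L * ((L - r) * A + r * B) =
  (L - r) * (A * (4 * L)) + r * (B * (4 * L)) by ring.
apply: leq_trans (leq_add (leq_mul (leqnn _) H1) (leq_mul (leqnn _) H2)) _.
by rewrite -mulnDl subnK ?(ltnW rL) // mulnCA.
Qed.

(* The bound needed is 1 - 1 / run i = 1 - 32 / (32 run i); the remaining
   5 / (32 run i) absorbs the positions where the type changes. *)
Lemma label_pattern_matches_large_lag i k n m : run i <= m -> ~~ (q k %| m) ->
  2 * m <= Q k n.+1 ->
  matches (label_pattern i k n.+1) m (Q k n.+1) * (32 * run i) <=
  (32 * run i - 37) * Q k n.+1.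
Proof.
move=> Lm nqm mQ; have L8 := leq_8_run i; have P8 := leq_8_depth i k.
have rL : m %% run i < run i by rewrite ltn_mod; lia.
have EQ : Q k n.+1 = run i * (8 ^ depth i k * Q k.+1 n).
  by rewrite [LHS]/= (q_depth i) mulnA.
rewrite (q_depth i) in nqm.
rewrite {1}(divn_eq m (run i)) [leqLHS]mulnC [_ %/ _ * _]mulnC
  label_pattern_matches //.
have := divn_eq m (run i); move: (m %/ run i) (m %% run i) rL => m' r rL Em.
have m'_gt0 : 0 < m' by nia.
have m'X : 2 * m' <= 8 ^ depth i k * Q k.+1 n by rewrite EQ in mQ; nia.
have H1 := @mid_bound i k n m' (@label_pattern_matches_bound i k.+1 n) m'_gt0
  (leq_trans m'X (leq_addr _ _)).
have H2 := @mid_bound i k n m'.+1 (@label_pattern_matches_bound i k.+1 n) isT.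
have {}H2 := H2 _; have {}H2 : _ := H2 ltac:(lia).
have half x : ~~ (8 ^ depth i k %| x) ->
    matches (mid i k n) x (8 ^ depth i k * Q k.+1 n) * 2 <=
      8 ^ depth i k * Q k.+1 n.
  exact: stack_matches_half.
rewrite EQ.
have [r0|r_gt0] := posnP r.
  have : ~~ (8 ^ depth i k %| m').
    apply: contra nqm; rewrite Em r0 addn0 [run i * _]mulnC.
    by rewrite dvdn_pmul2r //; lia.
  move=> /half; rewrite r0 mul0n addn0 subn0.
  move: (8 ^ _ * _) (matches _ _ _) => X A HA.
  have -> : 32 * run i * (run i * A) = 16 * run i * run i * (A * 2) by ring.
  apply: leq_trans (leq_mul (leqnn _) HA) _.
  by rewrite -mulnA leq_mul2r; apply/orP; right; lia.
(* [8 ^ depth i k] is at least 8 and cannot divide two consecutive numbers. *)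
have {half} : matches (mid i k n) m' (8 ^ depth i k * Q k.+1 n) * 2 <=
  8 ^ depth i k * Q k.+1 n \/
   matches (mid i k n) m'.+1 (8 ^ depth i k * Q k.+1 n) * 2 <=
     8 ^ depth i k * Q k.+1 n.
  have [dv|/half] := boolP (8 ^ depth i k %| m'); last by left.
  right; apply: half; rewrite -[m'.+1]addn1 dvdn_addr // dvdn1.
  by move: P8; case: (8 ^ depth i k) => [|[]].
move: H1 H2; move: (8 ^ _ * _) (matches _ m'.+1 _) (matches _ m' _) => X B A.
move: (run i) L8 rL {Lm mQ EQ nqm Em} => L L8 rL HA HB.
have [s EL s_gt0] : exists2 s, L = s + r & 0 < s by exists (L - r); lia.
have -> : L - r = s by lia.
(* A weight a / L loses 1/2 and the rest loses 3 / (4 L). The worst case a = 1 loses 1 / (2 L) + 3 /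
   (4 L) - 3 / (4 L^2), which is at least 37 / (32 L) because L >= 8. *)
have bound a b A' B' : 0 < a -> L = a + b -> A' * 2 <= X ->
    B' * (4 * L) <= (4 * L - 3) * X ->
    (a * A' + b * B') * (32 * L) <= (32 * L - 37) * (L * X).
  move=> a0 Lab HA' HB'.
  have -> : (a * A' + b * B') * (32 * L) =
    16 * L * a * (A' * 2) + 8 * b * (B' * (4 * L)) by ring.
  apply: leq_trans (leq_add (leq_mul (leqnn _) HA') (leq_mul (leqnn _) HB')) _.
  rewrite [8 * b * _]mulnA -mulnDl [leqRHS]mulnA leq_mul2r; apply/orP; right.
  have [t Et] : exists t, 4 * L = t + 3 by exists (4 * L - 3); lia.
  have [v Ev] : exists v, 32 * L = v + 37 by exists (32 * L - 37); lia.
  have -> : 4 * L - 3 = t by lia.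
  have -> : 32 * L - 37 = v by lia.
  have : b * (4 * L) = b * (t + 3) by rewrite Et.
  have : L * (32 * L) = L * (v + 37) by rewrite Ev.
  have : L * L = (a + b) * L by rewrite -Lab.
  have : L * 1 <= L * a by rewrite leq_mul.
  have : a * 8 <= a * L by rewrite leq_mul.
  lia.
case=> half; rewrite [leqLHS]mulnC; first exact: bound.
by rewrite [s * A + _]addnC; apply: bound; rewrite // addnC.
Qed.

(** The lag moves [m] positions of every run into the next run, where agreement is rare; m = 1 is
    the worst case. *)
Lemma label_pattern_matches_small_lag i k n m : 0 < m < run i ->
  matches (label_pattern i k n.+1) m (Q k n.+1) <=
  (run i).-1 * (8 ^ depth i k * Q k.+1 n) + Q k.+1 n.
Proof.
case/andP=> m0 mL; have := @label_pattern_matches i k n 0 m mL.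
rewrite muln0 add0n => ->; have L8 := leq_8_run i.
have := mid_succ i k n.
have := matches_le (mid i k n) 0 (8 ^ depth i k * Q k.+1 n).
have : Q k.+1 n <= 8 ^ depth i k * Q k.+1 n by rewrite leq_pmull // expn_gt0.
move: (Q k.+1 n) (8 ^ _ * _) (matches _ 1 _) (matches _ 0 _) => N X B A.
move: (run i) L8 mL => L L8 mL NX AX BN.
have : (L - m) * A <= (L - m) * X by rewrite leq_mul.
have : m * B <= m * N by rewrite leq_mul.
have -> : L.-1 = (L - m) + m.-1 by lia.
have : m.-1 * N <= m.-1 * X by rewrite leq_mul.
have : m * N = m.-1 * N + N by rewrite -mulSnr prednK.
rewrite mulnDl; lia.
Qed.

Lemma label_pattern_matches_one i k n :
  (run i).-1 * (8 ^ depth i k * Q k.+1 n) <=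
    matches (label_pattern i k n.+1) 1 (Q k n.+1).
Proof.
have L8 := leq_8_run i.
have := @label_pattern_matches i k n 0 1 (ltac:(lia));
  rewrite muln0 add0n => ->.
rewrite subn1 /matches; set A := \sum_(_ < _) _.
suff -> : A = 8 ^ depth i k * Q k.+1 n by exact: leq_addr.
rewrite -[RHS]muln1 -[RHS]sum_ord_const; apply: eq_bigr => x _.
by rewrite addn0 eqxx.
Qed.

Definition bad k n := \sum_(x < Q k n) ~~ keeps_type D k n x.

(** By [descend_inj], two level-[k] blocks with different states agree nowhere, so comparing letters
    amounts to comparing states. One [bad] pays for the block at [P], the other for the block at
    [P + m]. *)
Lemma block_word_matches i l k n m :
  \sum_(p < h (k + n))
    (block_word (k + n) (i, l) p == block_word (k + n) (i, l) (p + h k * m)) <=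
  h k * (matches (label_pattern i k n) m (Q k n) + 2 * bad k n).
Proof.
rewrite hD [h k * Q k n]mulnC (sum_ord_mul _ _ (fun p => nat_of_bool
  (block_word (k + n) (i, l) p == block_word (k + n) (i, l) (p + h k * m)))).
rewrite [leqRHS]mulnC mul2n -addnn addnA -{2}[bad k n](keeps_type_shift_count D
  k n m).
rewrite /matches -!big_split /= big_distrl /=; apply: leq_sum => P _.
rewrite [leqRHS]mulnC -[leqRHS]sum_ord_const; apply: leq_sum => y _.
rewrite addnAC [h k * m]mulnC -mulnDl !block_word_block //.
rewrite (inj_eq (@descend_inj D 0 k y)).
have [g|] := boolP (keeps_type D k n P); last by move=> _;
  apply: leq_trans (leq_b1 _) _; rewrite /= addnAC addn1.
have [g'|] := boolP (keeps_type D k n (P + m)); last by move=> _;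
  apply: leq_trans (leq_b1 _) _; rewrite /= addn1.
by rewrite !keeps_type_descend // xpair_eqE eqxx (inj_eq (addrI _)) !addn0.
Qed.

(** The transfer in the other direction, from patterns to states; at lag 1 it yields the lower bound
    for the rate. *)
Lemma descend_matches i l k n m :
  matches (label_pattern i k n) m (Q k n) <=
  \sum_(P < Q k n) (keeps_type D k n P &&
      (descend k n (i, l) P == descend k n (i, l) (P + m))) + 2 * bad k n.
Proof.
rewrite mul2n -addnn addnA -{2}[bad k n](keeps_type_shift_count D k n m).
rewrite /matches -!big_split /=; apply: leq_sum => P _.
have [g|] := boolP (keeps_type D k n P); last by move=> _;
  apply: leq_trans (leq_b1 _) _; rewrite /= addn1.
have [g'|] := boolP (keeps_type D k n (P + m)); last by move=> _;
  apply: leq_trans (leq_b1 _) _; rewrite /= addn1.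
by rewrite !keeps_type_descend // xpair_eqE eqxx (inj_eq (addrI _)) !addn0.
Qed.

End MatchCounts.

(** * The language of the blocks *)

Section Language.
Variable D : nat.
Local Notation len := (len D).
Local Notation q := (q D).
Local Notation h := (h D).
Local Notation Q := (Q D).
Local Notation state := (state D).

Lemma sum_digit_sum n (g : 'Z_4 -> nat) l :
  (\sum_(x < 8 ^ n.+1) g (l + digit_sum n.+1 x)%R) * 4 =
  8 ^ n.+1 * \sum_(c : 'Z_4) g c.
Proof.
rewrite expnS mulnC [8 * _]mulnC.
rewrite (sum_ord_mul _ _ (fun x => g (l + digit_sum n.+1 x)%R)).
rewrite (eq_bigr (fun=> 2 * \sum_(c : 'Z_4) g c)); last first.
  move=> z _; rewrite -(sum_psi g (l + digit_sum n z)%R);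
    apply: eq_bigr => x _ /=.
  rewrite modnMDl modn_small // divnMDl // divn_small // addn0.
  by rewrite -addrA [(digit_sum n z + _)%R]addrC.
by rewrite sum_ord_const; ring.
Qed.

(** This is why frequencies forget the label: apart from changes of type, every label occurs equally
    often in a block one level up. *)
Lemma substitution_balanced k (i : 'I_D.+1) l (g : 'Z_4 -> nat) :
  (\sum_(x < q k) g (l + digit_sum (len k - i.+1) (x %/ run i)%N)%R) * 4 =
  q k * \sum_(c : 'Z_4) g c.
Proof.
rewrite (q_depth i) [run i * _]mulnC.
rewrite (sum_ord_mul _ _
  (fun x => g (l + digit_sum (len k - i.+1) (x %/ run i)%N)%R)).
rewrite (eq_bigr (fun z : 'I__ => g (l + digit_sum (depth i k) z)%R * run i));
  last first.
  move=> z _; rewrite [RHS]mulnC -[RHS]sum_ord_const; apply: eq_bigr => x _.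
  by rewrite divnMDl ?expn_gt0 // divn_small // addn0.
rewrite -big_distrl /= mulnAC.
have : 0 < depth i k by rewrite /depth /len; have := ltn_ord i; lia.
by case: depth => // n _; rewrite sum_digit_sum; ring.
Qed.

Lemma substitution_primitive k (b b' : state) : exists2 x,
  x < q k & substitution k b' x = b.
Proof.
case: b b' => i l [i' l'].
(* The high digits spell [u], which produces the required change of type. The digit [y] of rank
   i'.+1 < D.+2 is still free and corrects the label, [c] being the part of the label that [u]
   itself contributes. *)
pose u := val (i - i')%R; pose e := D.+1 - i'.+1.
pose c := digit_sum (len k - i'.+1).-1 (u * 8 ^ e).
have [y y8 psiy] := psi_surj (l - l' - c)%R.
have uD : u <= D by rewrite -ltnS /u ltn_ord.
have i'D : i' <= D by rewrite -ltnS.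
have Eu : 8 ^ D.+2 = 8 ^ e.+1 * run i'.
  by rewrite -expnD /e; congr (8 ^ _); lia.
have y_run : y * run i' < 8 ^ D.+2.
  by rewrite Eu ltn_mul2r expn_gt0 /= (leq_trans y8) // -[leqLHS]/(8 ^ 1)
    leq_exp2l.
have uq : u < 8 ^ (len k - D.+2).
  apply: leq_ltn_trans uD _; apply: leq_trans (ltn_expl D (isT : 1 < 8)) _.
  by rewrite leq_exp2l // /len; lia.
exists (u * 8 ^ D.+2 + y * run i').
  rewrite /q [in ltnRHS]len_split expnD mulnC.
  move: uq y_run; move: (8 ^ (len k - D.+2)) (8 ^ D.+2) (y * run i') => a b z uq
    zb.
  have : u.+1 * b <= a * b by rewrite leq_mul2r uq orbT.
  by rewrite mulSn mulnC; lia.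
rewrite /substitution /=; congr pair.
  have -> : type_shift D k (u * 8 ^ D.+2 + y * run i') = u.
    rewrite /type_shift divnMDl ?expn_gt0 // (divn_small y_run) addn0.
    by rewrite (modn_small uq) uD.
  by rewrite inord_val addrC subrK.
rewrite Eu mulnA -mulnDl mulnK ?expn_gt0 //.
have : 0 < len k - i'.+1 by rewrite /len; lia.
rewrite /c in psiy *; case: (len k - i'.+1) psiy => // n psiy _ /=.
rewrite expnSr mulnA modnMDl modn_small // divnMDl // divn_small // addn0.
by rewrite psiy subrK addrC subrK.
Qed.

Lemma block_word_primitive k (b b' : state) :
  exists2 p, p + h k <= h k.+1 & forall y, y < h k ->
    block_word k.+1 b' (p + y) = block_word k b y.
Proof.
have [x xq <-] := substitution_primitive k b b'; exists (x * h k).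
  by rewrite hS -mulSnr mulnC leq_mul2l xq orbT.
by move=> y yh; rewrite -addn1 block_word_block.
Qed.

Lemma leq_h : {mono h : k k' / k <= k'}.
Proof.
apply: leq_mono; apply: homo_ltn => [|k]; first exact: ltn_trans.
by rewrite hS -[ltnLHS]muln1 ltn_pmul2l ?h_gt0 // (leq_trans _ (leq_8_q D k)).
Qed.

Definition in_language (x : int -> state) := forall (z : int) N,
  exists k b p, p + N <= h k /\
    forall j, j < N -> x (z + j%:Z)%R = block_word k b (p + j).

Lemma in_language_two_blocks x k z : in_language x -> exists r b b',
  r < h k /\ forall j, j < h k ->
    x (z + j%:Z)%R =
      if r + j < h k then block_word k b (r + j)
      else block_word k b' (r + j - h k).
Proof.
move=> /(_ z (h k)) [K [b [p [pK xE]]]].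
have kK : k <= K by rewrite -leq_h (leq_trans _ pK) // leq_addl.
rewrite -(subnKC kK) in xE; set n := K - k in xE.
exists (p %% h k), (descend k n b (p %/ h k)), (descend k n b (p %/ h k).+1).
split=> [|j jh]; first by rewrite ltn_mod h_gt0.
rewrite xE // {1}(divn_eq p (h k)) -addnA.
have rh : p %% h k < h k by rewrite ltn_mod h_gt0.
have [rj|rj] := ltnP; first by rewrite block_word_block.
rewrite -{1}(subnKC rj) addnA -mulSnr block_word_block //; lia.
Qed.

Lemma in_language_block x k z : in_language x -> exists j b,
  forall y, y < h k -> x (z + (j + y)%:Z)%R = block_word k b y.
Proof.
move=> /(_ z (h k + h k)) [K [b [p [pK xE]]]].
have kK : k <= K by rewrite -leq_h (leq_trans _ pK) // addnA leq_addl.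
rewrite -(subnKC kK) in xE; set n := K - k in xE.
have rh : p %% h k < h k by rewrite ltn_mod h_gt0.
exists (h k - p %% h k), (descend k n b (p %/ h k).+1) => y yh.
rewrite xE; last by lia.
rewrite -block_word_block // mulSn addnA; congr (block_word _ _ (_ + _)).
by rewrite {1}(divn_eq p (h k)); lia.
Qed.

(* A bi-infinite word extending the block [K, b]: the level-[K + m] block is put
   at position 1 of the level-[K + m + 1] block, so that both ends recede to
   infinity; [nest] gives the states and [offset] the position of the origin. *)
Fixpoint nest K b m : state :=
  if m is m'.+1 then invF (@substitution_inj D (K + m') 1) (nest K b m') else b.

Fixpoint offset K m := if m is m'.+1 then h (K + m') + offset K m' else 0.

(** This bound and the next one keep the interval from -m to m inside the block of level [K + m]. *)
Lemma leq_offset K m : m <= offset K m.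
Proof.
by elim: m => //= m IH; rewrite -add1n leq_add // h_gt0.
Qed.

Lemma offset_lt K m : offset K m + m < h (K + m).
Proof.
elim: m => [|m IH]; first by rewrite addn0 h_gt0.
rewrite !addnS hS /=; move: IH (leq_8_q D (K + m)).
move: (h _) (q _) (offset _ _) => a b c; nia.
Qed.

(** The level grows with the coordinate so that the coordinate falls inside the block; by
    [block_pointE] any higher level gives the same letter. *)
Definition block_point K b (z : int) : state :=
  block_word (K + `|z|) (nest K b `|z|) (absz ((offset K (absz z))%:Z + z)%R).

Lemma block_pointE K b z m : `|z| <= m ->
  block_point K b z =
    block_word (K + m) (nest K b m) (absz ((offset K m)%:Z + z)%R).
Proof.
move/subnKC <-; elim: (m - _) => [|n IH]; first by rewrite addn0.
rewrite IH !addnS; set M := `|z| + n;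
  rewrite /= -[in LHS](f_invF (@substitution_inj D (K + M) 1) (nest K b M)).
set b' := invF _ _.
have lo := leq_offset K M; have hi := offset_lt K M.
have zM : `|z| <= M by exact: leq_addr.
have -> : absz ((h (K + M) + offset K M)%:Z + z)%R =
    1 * h (K + M) + absz ((offset K M)%:Z + z)%R by lia.
by rewrite -[(K + M).+1]addn1 block_word_block //; lia.
Qed.

Lemma block_point_block K b y : y < h K -> block_point K b y%:Z =
  block_word K b y.
Proof.
move=> yh; rewrite /block_point (_ : (absz ((offset K y)%:Z + y%:Z)%R) =
  offset K y + y) //.
suff H m : offset K m + y < h (K + m) /\
    block_word (K + m) (nest K b m) (offset K m + y) =
      block_word K b y by case: (H y).
elim: m => [|m [lt_h <-]]; first by rewrite addn0.
rewrite !addnS hS; have q8 := leq_8_q D (K + m); split.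
  by rewrite /=; move: lt_h q8; move: (h _) (q _) => a c; nia.
rewrite [offset _ _]/= -addnA -[h (K + m)]mul1n -addn1 block_word_block //.
by have /= -> := f_invF (@substitution_inj D (K + m) 1) (nest K b m).
Qed.

Lemma block_point_in_language K b : in_language (block_point K b).
Proof.
move=> z N; pose m := `|z| + N.
have lo := leq_offset K m; have hi := offset_lt K m.
exists (K + m), (nest K b m), (absz ((offset K m)%:Z + z)%R); split.
  by rewrite /m in lo hi *; lia.
move=> j jN; rewrite (@block_pointE _ _ _ m); last by rewrite /m; lia.
by congr block_word; rewrite /m in lo *; lia.
Qed.

End Language.

Local Open Scope classical_set_scope.
Local Open Scope ring_scope.

(** * Clopen sets and measures on a subshift *)

Section FullShift.
Variable A : finType.
Implicit Types x y : full_shift A.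

Definition agree (L : nat) x y := forall z : int, (`|z| <= L)%N -> x z = y z.

Lemma nbhs_coord x (z : int) : nbhs x [set y : full_shift A | y z = x z].
Proof.
have /= c := @proj_continuous int (fun=> discrete_topology A) z x.
exact: (c _ (discrete_set1 (x z : discrete_topology A))).
Qed.

Lemma nbhs_agree L x : nbhs x [set y | agree L x y].
Proof.
have Fx : Filter (nbhs x) := nbhs_filter x.
elim: L => [|L IH].
  apply: filterS (nbhs_coord x 0) => y /= yx z.
  by rewrite leqn0 absz_eq0 => /eqP ->.
have Hp := nbhs_coord x L.+1%:Z; have Hn := nbhs_coord x (- L.+1%:Z).
apply: filterS3 Hp Hn IH => y /= yp yn yx z zL.
have [/yx//|zL'] := leqP `|z|%N L.
have [->|->] : z = L.+1%:Z \/ z = - L.+1%:Z by lia.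
  by rewrite yp.
by rewrite yn.
Qed.

(** The windows around [x] generate a filter that converges to [x] in each coordinate, hence in the
    product topology, so it contains every neighbourhood of [x]. *)
Lemma agree_basis x (U : set (full_shift A)) : nbhs x U ->
  exists L, [set y | agree L x y] `<=` U.
Proof.
pose F : set_system (full_shift A) :=
  [set V | exists L, [set y | agree L x y] `<=` V].
have FF : Filter F.
  split=> [|V V' [L LV] [L' LV']|V V' VV' [L LV]].
  - by exists 0%N.
  - exists (maxn L L') => y xy; split; [apply: LV|apply: LV'] => z zL;
    apply: xy; rewrite leq_max zL ?orbT //.
  - by exists L; apply: subset_trans VV'.
suff H : F --> x by move=> xU; apply: H.
apply/cvg_sup => z V; rewrite nbhsE => -[B [[W _ <-] Wx] BV].
by exists `|z|%N => y /(_ z (leqnn _)) xy; apply: BV; rewrite /= -xy.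
Qed.

Lemma compact_full_shift : compact [set: full_shift A].
Proof.
have := @tychonoff int (fun=> discrete_topology A) (fun=> setT).
have -> : [set f : int -> A | forall i, [set: A] (f i)] = setT.
  by apply/seteqP; split.
apply => _; apply: finite_compact; exact: finite_finset.
Qed.

End FullShift.

Section LocalSets.
Variables (A : finType) (X : subshift A).
Local Notation T := (subshift_space X).
Implicit Types (x y : T) (C : set T).

Definition local_set (L : nat) C :=
  forall x y, agree L (set_val x) (set_val y) -> C x -> C y.

(** By compactness these are precisely the clopen sets; dependence on a finite window is the
    property that the counting arguments use. *)
Definition clopens : set (set T) := [set C | exists L, local_set L C].

Lemma agree_sym L (x y : full_shift A) : agree L x y -> agree L y x.
Proof. by move=> xy z /xy. Qed.

Lemma agree_le L L' (x y : full_shift A) : (L <= L')%N ->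
  agree L' x y -> agree L x y.
Proof. by move=> LL xy z zL; apply: xy; apply: leq_trans LL. Qed.

Lemma local_setC L C : local_set L C -> local_set L (~` C).
Proof. by move=> CL x y /agree_sym xy nCx Cy; apply/nCx/(CL _ _ xy). Qed.

Lemma clopens0 : clopens set0. Proof. by exists 0%N. Qed.

Lemma clopensC : setC_closed clopens.
Proof. by move=> C [L CL]; exists L; apply: local_setC. Qed.

Lemma clopensT : clopens setT. Proof. by exists 0%N. Qed.

Lemma clopensU : setU_closed clopens.
Proof.
move=> C C' [L CL] [L' CL']; exists (maxn L L') => x y xy [Cx|Cx]; [left|right].
  by apply: CL Cx; apply: agree_le xy; rewrite leq_maxl.
by apply: CL' Cx; apply: agree_le xy; rewrite leq_maxr.
Qed.

Lemma clopensI : setI_closed clopens.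
Proof.
move=> C C' CC CC'; rewrite -[_ `&` _]setCK setCI.
by apply/clopensC/clopensU; apply: clopensC.
Qed.

Lemma clopensD : setD_closed clopens.
Proof. by move=> C C' CC CC'; rewrite setDE; apply/clopensI/clopensC. Qed.

Lemma clopens_bigcup_ord n (F : nat -> set T) : (forall k, clopens (F k)) ->
  clopens (\big[setU/set0]_(k < n) F k).
Proof.
move=> FC; elim/big_ind: _ => //; [exact: clopens0|exact: clopensU].
Qed.

Lemma nbhs_agree_subshift L x :
  nbhs x [set y : T | agree L (set_val x) (set_val y)].
Proof. exact: (@initial_continuous _ _ _ x _ (nbhs_agree L (set_val x))). Qed.

Lemma local_set_open L C : local_set L C -> open C.
Proof.
move=> CL; rewrite openE => x Cx.
by apply: filterS (nbhs_agree_subshift L x) => y xy; apply: CL Cx.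
Qed.

Lemma open_bigcup_local (B : set T) : open B ->
  exists2 F : nat -> set T, (forall n, local_set n (F n)) & B = \bigcup_n F n.
Proof.
move=> oB; exists (fun L => [set x | [set y : T | agree L (set_val x) (set_val
  y)] `<=` B]).
  by move=> L x y xy xB z yz; apply: xB => w wL; rewrite xy // yz.
apply/seteqP; split=> [x Bx|x [L _ /(_ x)]]; last exact.
case: oB Bx => W oW <- Wx; rewrite openE in oW.
by have [L LW] := agree_basis (oW _ Wx); exists L => //= y /LW.
Qed.

Lemma sigma_open_clopens : <<s @open T >> = <<s clopens >>.
Proof.
apply/seteqP; split; apply: smallest_sub.
- exact: smallest_sigma_algebra.
- move=> B /open_bigcup_local[F FL ->].
  apply: sigma_algebra_bigcup => n; apply: sub_gen_smallest.
  by exists n.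
- exact: smallest_sigma_algebra.
- by move=> C [L /local_set_open oC]; apply: sub_gen_smallest.
Qed.

(** Choose a point in each [D n]. A cluster point agrees with arbitrarily late choices on any finite
    window, and membership in [D n] depends only on such a window. *)
Lemma clopens_bigcap_nonempty (D : nat -> set T) :
  (forall n, clopens (D n)) -> (forall n, D n !=set0) ->
  (forall n m, (n <= m)%N -> D m `<=` D n) -> \bigcap_n D n !=set0.
Proof.
move=> DC D0 Ddec.
have /choice[x Dx] n : exists x, D n x by have [x] := D0 n; exists x.
have cX : compact (carrier X).
  exact: (subclosed_compact (@subshift_closed A X) (@compact_full_shift A)).
have := cX ((fun n => set_val (x n)) @ \oo) _ _.
case.
  by exists 0%N => // n _; apply: set_valP.
move=> p [Xp clp]; pose q : T := exist _ p (mem_set Xp).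
exists q => n _; have [L DL] := DC n.
have := clp [set y | exists2 m, (n <= m)%N & y =
  set_val (x m)] _ _ (nbhs_agree L p).
case.
  by exists n => // m /= nm; exists m.
move=> _ [[m nm ->] pm]; apply: (DL (x m)); last exact: (Ddec _ _ nm).
exact: agree_sym.
Qed.

End LocalSets.

(** An alias that carries the algebra of clopen sets, while [borel X] carries the sigma-algebra it
    generates; the Caratheodory extension leads from one to the other. *)
Definition cylinder_space (A : finType) (X : subshift A) : Type :=
  subshift_space X.

HB.instance Definition _ (A : finType) (X : subshift A) :=
  Pointed.on (cylinder_space X).

HB.instance Definition _ (A : finType) (X : subshift A) :=
  isAlgebraOfSets.Build default_measure_display (cylinder_space X)
    (@clopens0 A X) (@clopensU A X) (@clopensC A X).

(** * Borel probabilities from finitely additive functions on clopen sets *)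

Section ContentExtension.
Variables (R : realType) (A : finType) (X : subshift A).
Local Notation T := (subshift_space X).
Variable m : set T -> R.
Hypothesis m_ge0 : forall C, clopens C -> 0 <= m C.
Hypothesis mT : m setT = 1.
Hypothesis m_add : forall C C', clopens C -> clopens C' ->
  C `&` C' = set0 -> m (C `|` C') = m C + m C'.

(** [m] is controlled on clopen sets only; the default 0 makes the content nonnegative on all
    sets. *)
Definition clopen_content (C : set (cylinder_space X)) : \bar R :=
  (if `[< clopens C >] then m C else 0)%:E.

Lemma clopen_contentE C : clopens C -> clopen_content C = (m C)%:E.
Proof. by move=> CC; rewrite /clopen_content asboolT. Qed.

Lemma m_set0 : m set0 = 0.
Proof.
have := m_add (@clopensT _ X) (@clopens0 _ X) (setI0 _).
by rewrite setU0 mT; lra.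
Qed.

Lemma clopen_content0 : clopen_content set0 = 0%E.
Proof. by rewrite clopen_contentE ?m_set0 //; apply: clopens0. Qed.

Lemma clopen_content_ge0 C : (0 <= clopen_content C)%E.
Proof.
rewrite /clopen_content lee_fin; case: ifPn => // /asboolP; exact: m_ge0.
Qed.

(** The remainders [D n] are clopen, decreasing and have empty intersection, so one of them is
    empty: only finitely many [F n] are nonempty, and finite additivity suffices. *)
Lemma clopen_content_sigma_additive : semi_sigma_additive clopen_content.
Proof.
move=> F mF tF mUF.
pose D n := \bigcup_i F i `\` \big[setU/set0]_(i < n) F i.
have DC n : clopens (D n) by apply: clopensD => //; apply: clopens_bigcup_ord.
have [N DN] : exists N, D N = set0.
  apply: contrapT => /forallNP D0.
  have Dne n : D n !=set0 by apply/set0P/eqP.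
  have Ddec n k : (n <= k)%N -> D k `<=` D n.
    move=> nk; apply: setDS; exact: subset_bigsetU.
  have [x Dx] := clopens_bigcap_nonempty DC Dne Ddec.
  have [[i _ Fi] _] := Dx 0%N I.
  have [_] := Dx i.+1 I; apply; rewrite -bigcup_mkord.
  by exists i => /=.
have F0 n : (N <= n)%N -> F n = set0.
  move=> Nn; apply/seteqP; split=> // x Fx.
  have : ~ D N x by rewrite DN.
  apply; split; first by exists n.
  rewrite -bigcup_mkord => -[i /= iN Fi].
  have ein : i = n by apply: (tF i n I I); exists x.
  by move: iN; rewrite ein ltnNge Nn.
have sumE n : (\sum_(0 <= i < n) clopen_content (F i))%E =
    clopen_content (\big[setU/set0]_(i < n) F i).
  elim: n => [|n IH]; first by rewrite big_geq // big_ord0 clopen_content0.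
  have UC : clopens (\big[setU/set0]_(i < n) F i) by apply: clopens_bigcup_ord.
  have disj : \big[setU/set0]_(i < n) F i `&` F n = set0.
    apply/seteqP; split=> // x [+ Fn]; rewrite -bigcup_mkord => -[i /= ilt Fi].
    have ein : i = n by apply: (tF i n I I); exists x.
    by move: ilt; rewrite ein ltnn.
  have FC : clopens (F n) := mF n; have UFC := clopensU UC FC.
  by rewrite big_nat_recr //= IH big_ord_recr /= !clopen_contentE ?m_add.
apply: cvg_near_cst; exists N => // n /= Nn.
rewrite sumE; congr clopen_content; apply/seteqP; split=> x.
  by rewrite -bigcup_mkord => -[i _ Fi]; exists i.
move=> [i _ Fi]; rewrite -bigcup_mkord; exists i => //=.
by rewrite (leq_trans _ Nn) // ltnNge; apply/negP => /F0 Fi0; rewrite Fi0 in Fi.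
Qed.

HB.instance Definition _ := isMeasure.Build _ _ _ clopen_content
  clopen_content0 clopen_content_ge0 clopen_content_sigma_additive.

Definition borel_extension : set (borel X) -> \bar R :=
  measure_extension clopen_content.

Lemma borel_measurableE (B : set (borel X)) :
  measurable B = <<s @clopens A X >> B.
Proof. by rewrite -sigma_open_clopens. Qed.

Lemma borel_extension0 : borel_extension set0 = 0%E.
Proof. exact: measure0. Qed.

Lemma borel_extension_ge0 B : (0 <= borel_extension B)%E.
Proof. exact: measure_ge0. Qed.

Lemma borel_extension_sigma_additive : semi_sigma_additive borel_extension.
Proof.
move=> F mF tF mUF.
apply: (@measure_semi_sigma_additive _ _ _ (measure_extension clopen_content)).
- by move=> i; have := mF i; rewrite borel_measurableE.
- exact: tF.
- by have := mUF; rewrite borel_measurableE.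
Qed.

HB.instance Definition _ := isMeasure.Build _ _ _ borel_extension
  borel_extension0 borel_extension_ge0 borel_extension_sigma_additive.

Lemma borel_extensionE C : clopens C -> borel_extension C = (m C)%:E.
Proof.
move=> CC; rewrite /borel_extension /measure_extension measurable_mu_extE //.
exact: clopen_contentE.
Qed.

Lemma borel_extensionT : borel_extension setT = 1%E.
Proof. by rewrite borel_extensionE ?mT //; apply: clopensT. Qed.

HB.instance Definition _ :=
  Measure_isProbability.Build _ _ _ borel_extension borel_extensionT.

Lemma exists_extension : exists mu : probability (borel X) R,
  forall C, clopens C -> mu C = (m C)%:E.
Proof. by exists borel_extension; apply: borel_extensionE. Qed.

End ContentExtension.

(** * Lower limits of extended real sequences *)

Section Liminf.
Variables (R : realType).
Implicit Types (u : (\bar R)^nat).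

Lemma limn_einfE u : limn_einf u = ereal_sup (range (einfs u)).
Proof. by rewrite limn_einf_lim; apply/cvg_lim => //; apply: cvg_einfs_sup. Qed.

Lemma lt_limn_einf u y : (y < limn_einf u)%E ->
  exists k0, forall k, (k0 <= k)%N -> (y < u k)%E.
Proof.
rewrite limn_einfE => /ereal_sup_gt[_ [k0 _ <-] yk0]; exists k0 => k k0k.
by apply: lt_le_trans yk0 _; apply: ereal_inf_lbound; exists k.
Qed.

Lemma limn_einf_ge u (y : R) :
  (forall e : R, 0 < e -> exists k0, forall k, (k0 <= k)%N ->
    ((y - e)%:E <= u k)%E) -> (y%:E <= limn_einf u)%E.
Proof.
move=> yu; apply/lee_subgt0Pr => e /yu[k0 yk0]; rewrite limn_einfE.
apply: (@le_trans _ _ (einfs u k0)); last by apply: ereal_sup_ubound; exists k0.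
apply: le_ereal_inf_tmp => _ [k /= k0k <-]; rewrite -EFinB; exact: yk0.
Qed.

End Liminf.

(** * Approximation of Borel sets by clopen sets *)

Section InvariantMeasure.
Variables (R : realType) (A : finType) (X : subshift A).
Local Notation T := (subshift_space X).
Local Notation f := (@subshift_map A X).
Implicit Types (x y : T) (B C : set (borel X)).

Lemma clopen_measurable C : clopens C -> measurable C.
Proof. by rewrite borel_measurableE; apply: sub_gen_smallest. Qed.

Lemma agree_shift L x y : agree L.+1 (set_val x) (set_val y) ->
  agree L (set_val (f x)) (set_val (f y)).
Proof.
by move=> xy z zL; rewrite /= /shift; apply: xy; lia.
Qed.

Lemma clopens_shift C : clopens C -> clopens (f @^-1` C).
Proof.
by move=> [L CL]; exists L.+1 => x y /agree_shift; apply: CL.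
Qed.

Lemma iterS_preimage n C : iter n.+1 f @^-1` C = iter n f @^-1` (f @^-1` C).
Proof. by apply/seteqP; split=> x /=; rewrite -iterS iterS. Qed.

Lemma clopens_iter n C : clopens C -> clopens (iter n f @^-1` C).
Proof.
elim: n C => [//|n IH] C CC; rewrite iterS_preimage.
by apply/IH/clopens_shift.
Qed.

Lemma measurable_shift : measurable_fun setT (f : borel X -> borel X).
Proof.
apply: (@measurability _ _ (borel X) (borel X) setT f (@clopens A X)).
  by apply/seteqP; split=> B; rewrite borel_measurableE.
move=> _ [C CC <-]; rewrite setTI.
exact: (clopen_measurable (clopens_shift CC)).
Qed.

Lemma measurable_preimage B : measurable B ->
  measurable (f @^-1` B : set (borel X)).
Proof. by move=> mB; have := measurable_shift measurableT mB;
  rewrite setTI. Qed.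

Lemma measurable_iter n B : measurable B ->
  measurable (iter n f @^-1` B : set (borel X)).
Proof.
elim: n B => [//|n IH] B mB; rewrite iterS_preimage.
exact: (IH _ (measurable_preimage mB)).
Qed.

Variable mu : probability (borel X) R.

Definition prob B : R := fine (mu B).

Local Notation pr := prob.

Lemma prE B : measurable B -> mu B = (pr B)%:E.
Proof. by move=> mB; rewrite fineK // fin_num_measure. Qed.

Lemma pr_ge0 B : 0 <= pr B.
Proof. by rewrite fine_ge0. Qed.

Lemma prT : pr setT = 1.
Proof. by rewrite /prob probability_setT. Qed.

Lemma le_pr B C : measurable B -> measurable C -> B `<=` C -> pr B <= pr C.
Proof.
by move=> mB mC BC; rewrite -lee_fin -!prE // le_measure ?inE.
Qed.

Lemma pr_le1 B : measurable B -> pr B <= 1.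
Proof. by move=> mB; rewrite -prT; apply: le_pr. Qed.

Lemma prU B C : measurable B -> measurable C -> pr (B `|` C) <= pr B + pr C.
Proof.
move=> mB mC; have mBC := measurableU _ _ mB mC.
by rewrite -lee_fin EFinD -!prE // measureU2.
Qed.

Lemma prU_disj B C : measurable B -> measurable C -> B `&` C = set0 ->
  pr (B `|` C) = pr B + pr C.
Proof.
move=> mB mC BC; have mBC := measurableU _ _ mB mC.
by apply: EFin_inj; rewrite EFinD -!prE // measureU.
Qed.

Definition symdiff B C := (B `\` C) `|` (C `\` B).

Lemma measurable_symdiff B C : measurable B -> measurable C ->
  measurable (symdiff B C).
Proof. by move=> mB mC; apply: measurableU; apply: measurableD. Qed.

Lemma pr_symdiff B C : measurable B -> measurable C ->
  `|pr B - pr C| <= pr (symdiff B C).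
Proof.
have H B' C' : measurable B' -> measurable C' -> pr B' <=
  pr (symdiff B' C') + pr C'.
  move=> mB mC; have mS := measurable_symdiff mB mC.
  apply: le_trans (prU mS mC); apply: le_pr => //; first exact: measurableU.
  by move=> x Bx; have [Cx|nCx] := pselect (C' x); [right|left; left].
move=> mB mC; have := H _ _ mB mC; have := H _ _ mC mB.
have -> : symdiff C B = symdiff B C by rewrite /symdiff setUC.
by move=> h1 h2; rewrite ler_norml; apply/andP; split; lra.
Qed.

Definition approximable B := forall e : R, 0 < e ->
  exists2 C, clopens C & pr (symdiff B C) <= e.

Lemma approximable_clopen C : clopens C -> approximable C.
Proof.
move=> CC e e0; exists C => //.
by rewrite /symdiff setDv setU0 /prob measure0 /= ltW.
Qed.

Lemma approximableC B : approximable B -> approximable (~` B).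
Proof.
move=> aB e /aB[C CC BC]; exists (~` C); first exact: clopensC.
rewrite (_ : symdiff _ _ = symdiff B C) //.
by rewrite /symdiff !setDE !setCK setUC [C `&` _]setIC [_ `&` B]setIC.
Qed.

Lemma approximableU B B' : measurable B -> measurable B' ->
  approximable B -> approximable B' -> approximable (B `|` B').
Proof.
move=> mB mB' aB aB' e e0; have e2 : 0 < e / 2 by lra.
have [C CC BC] := aB _ e2; have [C' CC' BC'] := aB' _ e2.
exists (C `|` C'); first exact: clopensU.
have mC := clopen_measurable CC; have mC' := clopen_measurable CC'.
have mS := measurable_symdiff mB mC; have mS' := measurable_symdiff mB' mC'.
apply: (@le_trans _ _ (pr (symdiff B C) + pr (symdiff B' C'))); last by lra.
apply: le_trans (prU mS mS'); apply: le_pr.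
- by apply: measurable_symdiff; apply: measurableU.
- exact: measurableU.
- by rewrite /symdiff => x /=; tauto.
Qed.

Lemma approximable_bigcup (F : nat -> set (borel X)) :
  (forall n, measurable (F n)) -> (forall n, approximable (F n)) ->
  approximable (\bigcup_n F n).
Proof.
move=> mF aF e e0.
pose U n := \big[setU/set0]_(i < n) F i.
have mU n : measurable (U n) by apply: bigsetU_measurable.
have aU n : approximable (U n).
  elim: n => [|n IH]; rewrite /U ?big_ord0 ?big_ord_recr /=.
    exact/approximable_clopen/clopens0.
  exact: (approximableU (mU n) (mF n) IH (aF n)).
have mUF : measurable (\bigcup_n F n) by apply: bigcup_measurable.
have cvgU : mu (U n) @[n --> \oo] --> mu (\bigcup_n F n).
  have -> : \bigcup_n F n = \bigcup_n U n.
    apply/seteqP; split=> [x [n _ Fx]|x [n _]].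
      by exists n.+1 => //; rewrite /U -bigcup_mkord; exists n => /=.
    by rewrite /U -bigcup_mkord => -[k _ Fx]; exists k.
  apply: nondecreasing_cvg_mu => //.
    by apply: bigcup_measurable.
  by move=> n k nk; apply/subsetPset; apply: subset_bigsetU.
have e2 : 0 < e / 2 by lra.
have [N HN] : exists N, pr (\bigcup_n F n) - pr (U N) <= e / 2.
  move: cvgU; rewrite prE // => /fine_cvg/cvgrPdist_le/(_ _ e2)[N _ HN].
  by exists N; apply: le_trans (HN N (leqnn N)); rewrite ler_norm.
have [C CC UC] := aU N _ e2; exists C => //.
have mC := clopen_measurable CC; have mS := measurable_symdiff (mU N) mC.
have UF : U N `<=` \bigcup_n F n.
  by rewrite /U -bigcup_mkord => x [i _ Fi]; exists i.
have mD : measurable (\bigcup_n F n `\` U N) by apply: measurableD.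
have HD : pr (\bigcup_n F n `\` U N) = pr (\bigcup_n F n) - pr (U N).
  have := prU_disj (mU N) mD; rewrite setDUK // => -> //; first by lra.
  by rewrite setDE setICA setICr setI0.
apply: (@le_trans _ _ (pr (\bigcup_n F n `\` U N) + pr (symdiff (U N) C)));
  last by lra.
apply: le_trans (prU mD mS); apply: le_pr.
- exact: measurable_symdiff.
- exact: measurableU.
- rewrite /symdiff => x /= [[Fx nCx]|[Cx nFx]].
    by have [Ux|nUx] := pselect (U N x); [right; left|left].
  by right; right; split=> // Ux; apply/nFx/UF.
Qed.

Lemma measurable_approximable B : measurable B -> approximable B.
Proof.
rewrite borel_measurableE => sB.
pose G := [set B : set (borel X) | measurable B /\ approximable B].
suff : G B by case.
apply: sB; split; last first.
  by move=> C CC; split; [apply: clopen_measurable|apply: approximable_clopen].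
split.
- by split=> //; apply/approximable_clopen/clopens0.
- move=> B' [mB' aB']; rewrite setTD; split; first exact: measurableC.
  exact: approximableC.
- move=> F FG; split; first by apply: bigcup_measurable => n _; case: (FG n).
  by apply: approximable_bigcup => n; case: (FG n).
Qed.

End InvariantMeasure.

(** * Invariance, ergodicity and rigidity tested on clopen sets *)

Section Criteria.
Variables (R : realType) (A : finType) (X : subshift A).
Local Notation T := (subshift_space X).
Local Notation f := (@subshift_map A X).
Variable mu : probability (borel X) R.
Local Notation pr := (prob mu).
Implicit Types (B C D : set (borel X)).

Hypothesis inv : forall C, clopens C -> mu (f @^-1` C : set (borel X)) = mu C.

Lemma shift_preserving B : measurable B ->
  mu (f @^-1` B : set (borel X)) = mu B.
Proof.
move=> mB.
pose nu := measure_function_pushforward__canonical__measure_function_Measure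
  mu (@measurable_shift A X).
have mG : @measurable _ (borel X) = <<s @clopens A X >>.
  by apply/seteqP; split=> C; rewrite borel_measurableE.
have cover : \bigcup_(k in [set: nat]) [set: borel X] = setT.
  by rewrite bigcup_const //; exists 0%N.
have nu_fin (k : nat) : (nu setT < +oo)%E.
  by rewrite -[nu setT]/(mu setT) probability_setT ltry.
exact: (@measure_unique _ R (borel X) (@clopens A X) (fun=> setT) mG
  (@clopensI A X)
  (fun=> @clopensT A X) cover nu mu inv nu_fin B mB).
Qed.

Lemma iter_preserving n B : measurable B ->
  pr (iter n f @^-1` B : set (borel X)) = pr B.
Proof.
elim: n B => [//|n IH] B mB; rewrite iterS_preimage.
by rewrite (IH _ (measurable_preimage mB)) /prob shift_preserving.
Qed.

Definition return_set n B : set (borel X) := B `&` iter n f @^-1` B.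

Lemma measurable_return n B : measurable B -> measurable (return_set n B).
Proof. by move=> mB; apply: measurableI => //; apply: measurable_iter. Qed.

Lemma return_approx n B C : measurable B -> measurable C ->
  `|pr (return_set n B) - pr (return_set n C)| <= 2 * pr (symdiff B C).
Proof.
move=> mB mC; have mS := measurable_symdiff mB mC.
have mRB := measurable_return n mB; have mRC := measurable_return n mC.
apply: le_trans (pr_symdiff mu mRB mRC) _.
have mI := measurable_iter n mS.
have -> : 2 * pr (symdiff B C) =
    pr (symdiff B C) + pr (iter n f @^-1` symdiff B C : set (borel X)).
  by rewrite iter_preserving //; ring.
apply: le_trans (prU mu mS mI); apply: le_pr.
- exact: measurable_symdiff.
- exact: measurableU.
- rewrite /return_set /symdiff => x /=.
  have := EM (B x); have := EM (C x); have := EM (B (iter n f x)).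
  have := EM (C (iter n f x)); tauto.
Qed.

(* An invariant set B equals its return sets B /\ T^-n B; approximating it by
   clopen sets gives mu B = (mu B)^2. *)
Lemma ergodic_of_clopens :
  (forall C (e : R), clopens C -> 0 < e -> exists2 N, (0 < N)%N &
     `|\sum_(n < N) pr (return_set n C) - N%:R * pr C ^+ 2| <= e * N%:R) ->
  ergodic mu f.
Proof.
move=> H; split.
  by split; [exact: measurable_shift|exact: shift_preserving].
move=> B mB fB.
have itB n : iter n f @^-1` B = B.
  by elim: n => [//|n IH]; rewrite iterS_preimage fB.
have retB n : return_set n B = B by rewrite /return_set itB setIid.
(* The 5 collects 2 from the return sets of [C] in place of [B], 1 from the hypothesis and 2 from
   comparing the squares. *)
have bnd (e : R) : 0 < e -> `|pr B - pr B ^+ 2| <= 5 * e.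
  move=> e0; have [C CC BC] := measurable_approximable mu mB e0.
  have mC := clopen_measurable CC.
  have [N N0 HN] := H C e CC e0.
  have N0' : 0 < N%:R :> R by rewrite ltr0n.
  have h1 : `|N%:R * pr B - \sum_(n < N) pr (return_set n C)| <= 2 * e * N%:R.
    have -> : N%:R * pr B = \sum_(n < N) pr B.
      by rewrite sumr_const card_ord mulr_natl.
    rewrite -sumrB; apply: le_trans (ler_norm_sum _ _ _) _.
    have -> : 2 * e * N%:R = \sum_(n < N) (2 * e).
      by rewrite sumr_const card_ord mulr_natr.
    apply: ler_sum => n _; rewrite -{1}(retB n).
    by apply: le_trans (return_approx n mB mC) _; rewrite ler_pM2l.
  have h2 : `|pr C ^+ 2 - pr B ^+ 2| <= 2 * e.
    have -> : pr C ^+ 2 - pr B ^+ 2 = (pr C - pr B) * (pr C + pr B) by ring.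
    rewrite normrM mulrC; apply: ler_pM => //.
      have := pr_ge0 mu B; have := pr_ge0 mu C.
      have := pr_le1 mu mB; have := pr_le1 mu mC.
      by move=> *; rewrite ger0_norm; lra.
    by rewrite distrC; apply: le_trans (pr_symdiff mu mB mC) BC.
  have h3 : N%:R * `|pr B - pr B ^+ 2| <= N%:R * (5 * e).
    rewrite -{1}[N%:R]ger0_norm ?ler0n // -normrM.
    set S := \sum_(n < N) _ in HN h1.
    have -> : N%:R * (pr B - pr B ^+ 2) = (N%:R * pr B - S) +
       (S - N%:R * pr C ^+ 2) + N%:R * (pr C ^+ 2 - pr B ^+ 2) by ring.
    apply: le_trans (ler_normD _ _) _.
    apply: le_trans (lerD (ler_normD _ _) (lexx _)) _.
    rewrite normrM ger0_norm ?ler0n //.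
    have : N%:R * `|pr C ^+ 2 - pr B ^+ 2| <=
      N%:R * (2 * e) by rewrite ler_pM2l.
    by move: h1 HN; set a := `|_|; set b := `|_|; set c := _ * `|_|; lra.
  by rewrite ler_pM2l in h3.
have : pr B = pr B ^+ 2.
  apply/eqP; rewrite -subr_eq0 -normr_le0; apply/ler_addgt0Pr => e e0.
  by rewrite add0r; have := bnd (e / 5); lra.
move=> /eqP; rewrite -subr_eq0 -{1}[pr B]mulr1 expr2 -mulrBr mulf_eq0 subr_eq0.
by rewrite !prE // => /orP[/eqP->|/eqP<-]; [left|right].
Qed.

Lemma rigid_of_clopens (delta : R) (n : nat -> nat) :
  {homo n : k l / (k < l)%N >-> (k < l)%N} -> 0 <= delta ->
  (forall C (e : R), clopens C -> 0 < e -> exists k0, forall k, (k0 <= k)%N ->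
     delta * pr C - e <= pr (return_set (n k) C)) ->
  partially_rigid_along mu f delta n.
Proof.
move=> ninc d0 H; split=> // B mB; rewrite prE // -EFinM.
apply: limn_einf_ge => e e0.
(* The shares are 2 for the return sets, [delta] for [pr B] against [pr C], and 1 for the
   hypothesis. *)
pose e' := e / (3 + delta).
have e'0 : 0 < e' by rewrite divr_gt0 //; lra.
have Ee : e = e' * (3 + delta) by rewrite /e' divfK //; apply/lt0r_neq0; lra.
have [C CC BC] := measurable_approximable mu mB e'0.
have mC := clopen_measurable CC.
have [k0 Hk0] := H C e' CC e'0; exists k0 => k /Hk0 Hk.
rewrite prE ?lee_fin; last exact: measurable_return.
have := return_approx (n k) mB mC; have := pr_symdiff mu mB mC.
rewrite !ler_norml => /andP[_ h1] /andP[h2 _].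
have h3 : delta * (pr B - pr C) <= delta * e' by rewrite ler_wpM2l //; lra.
rewrite -/(return_set (n k) B) Ee; lra.
Qed.

End Criteria.

(** * The rigidity rate bounded by letter matches *)

Section Rate.
Variables (R : realType) (A : finType) (X : subshift A).
Local Notation T := (subshift_space X).
Local Notation f := (@subshift_map A X).
Variable mu : probability (borel X) R.
Local Notation pr := (prob mu).
Implicit Types (B C D : set (borel X)).

Lemma iter_shiftE n (x : T) (z : int) :
  set_val (iter n f x) z = set_val x (z + n%:Z).
Proof.
elim: n z => [|n IH] z; first by rewrite addr0.
by apply: etrans (IH (z + 1)) _; congr (set_val x _); lia.
Qed.

Definition letter_set (P : pred A) : set (borel X) :=
  [set x : T | P (set_val x 0)].

Lemma letter_clopen P : clopens (letter_set P).
Proof. by exists 0%N => x y xy; rewrite /letter_set /= xy. Qed.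

Lemma sum_letters B (s : seq A) : measurable B -> uniq s ->
  \sum_(a <- s) pr (B `&` letter_set (pred1 a)) =
    pr (B `&` letter_set (fun b => b \in s)).
Proof.
move=> mB; elim: s => [_|a s IH /= /andP[a_s us]].
  have -> : B `&` letter_set (fun b => b \in [::]) = set0.
    by apply/seteqP; split=> // x [_]; rewrite /letter_set /= in_nil.
  by rewrite big_nil /prob measure0.
have mL P : measurable (B `&` letter_set P).
  exact: (measurableI _ _ mB (clopen_measurable (letter_clopen P))).
rewrite big_cons IH // -prU_disj //.
  congr prob; rewrite -setIUr; congr (_ `&` _); apply/seteqP; split=> x.
    by move=> [/= xa|/= xs]; rewrite /letter_set /= inE ?xs ?orbT // -[_ ==
      a]/(pred1 a _) xa.
  by rewrite /letter_set /= inE => /orP[xa|xs]; [left|right].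
apply/seteqP; split=> // x [[_ /= /eqP xa] [_ /= xs]].
by move: a_s; rewrite -xa xs.
Qed.

Lemma sum_letters_all B : measurable B ->
  \sum_(a : A) pr (B `&` letter_set (pred1 a)) = pr B.
Proof.
move=> mB; rewrite sum_letters ?index_enum_uniq //; congr prob.
by apply/seteqP; split=> [x []//|x Bx]; split=> //; apply: mem_index_enum.
Qed.

Definition match_set n : set (borel X) :=
  [set x : T | set_val x 0 = set_val x n%:Z].

Lemma match_clopen n : clopens (match_set n).
Proof. by exists n => x y xy; rewrite /match_set /= !xy. Qed.

Lemma sum_return_letters n :
  \sum_(a : A) pr (return_set n (letter_set (pred1 a))) = pr (match_set n).
Proof.
rewrite -(sum_letters_all (clopen_measurable (match_clopen n))).
apply: eq_bigr => a _; congr prob; apply/seteqP; split=> x.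
  move=> [/= /eqP xa]; rewrite /letter_set /= iter_shiftE add0r => /eqP xna.
  by split; rewrite /match_set /letter_set /= ?xa ?xna ?eqxx.
move=> [/= xx /eqP xa]; split; rewrite /letter_set /= ?iter_shiftE ?add0r -?xx
  xa //=.
Qed.

(* Sum the rigidity inequality over the sets [x_0 = a]. *)
Lemma rigidity_constant_le (delta delta' : R) n :
  (forall e : R, 0 < e -> exists k0, forall k, (k0 <= k)%N ->
     pr (match_set k) <= delta + e) ->
  partially_rigid_along mu f delta' n -> delta' <= delta.
Proof.
move=> H [ninc rig]; apply/ler_addgt0Pr => e e0.
(* One share for each letter and one for the bound on the match set. *)
pose e' := e / (1 + #|A|%:R).
have cA : 0 <= #|A|%:R :> R by rewrite ler0n.
have e'0 : 0 < e' by rewrite divr_gt0 //; lra.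
have Ee : e = e' + #|A|%:R * e' by rewrite -{1}[e'](mul1r e') -mulrDl mulrC
  divfK //; apply/lt0r_neq0; lra.
have [k0 Hk0] := H _ e'0.
have /choice[ka Hka] (a : A) : exists ka, forall k, (ka <= k)%N ->
    delta' * pr (letter_set (pred1 a)) - e' <=
      pr (return_set (n k) (letter_set (pred1 a))).
  have mL := clopen_measurable (letter_clopen (pred1 a)).
  have := rig _ mL; rewrite prE // -EFinM => le_inf.
  have /lt_limn_einf[ka Hka] : ((delta' * pr (letter_set (pred1 a)) - e')%:E <
      limn_einf (fun k => mu (return_set (n k) (letter_set (pred1 a)))))%E.
    by apply: lt_le_trans le_inf; rewrite lte_fin; lra.
  exists ka => k /Hka; rewrite prE; last exact: measurable_return.
  by rewrite lte_fin => /ltW.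
have n_ge k : (k <= n k)%N.
  by elim: k => // k IH; apply: leq_ltn_trans IH (ninc _ _ (ltnSn k)).
pose k := (maxn k0 (\max_(a : A) ka a)).
have h1 : pr (match_set (n k)) <= delta + e'.
  by apply: Hk0; apply: leq_trans (n_ge k); apply: leq_maxl.
have : \sum_(a : A) (delta' * pr (letter_set (pred1 a)) - e') <=
  pr (match_set (n k)).
  rewrite -sum_return_letters; apply: ler_sum => a _; apply: Hka.
  by rewrite leq_max (leq_bigmax a) orbT.
rewrite sumrB -mulr_sumr sumr_const -[_ *+ _]mulr_natl.
have -> : \sum_(a : A) pr (letter_set (pred1 a)) = 1.
  rewrite -(prT mu) -(sum_letters_all measurableT).
  by apply: eq_bigr => a _; rewrite setTI.
rewrite mulr1 Ee; move: #|_| Ee h1 => c; rewrite -/e'; lra.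
Qed.

Lemma partial_rigidity_rateE (delta : R) n : 0 < delta ->
  (forall e : R, 0 < e -> exists k0, forall k, (k0 <= k)%N ->
     pr (match_set k) <= delta + e) ->
  partially_rigid_along mu f delta n -> partial_rigidity_rate mu f = delta.
Proof.
move=> d0 H rig; rewrite /partial_rigidity_rate; set S := [set _ | _].
have Sd : S delta by split=> //; exists n.
have ubS : ubound S delta by move=> d' [_ [n' /(rigidity_constant_le H)]].
apply/eqP; rewrite eq_le; apply/andP; split; first by apply: ge_sup => //;
  exists delta.
by apply: ub_le_sup => //; exists delta.
Qed.

End Rate.

(** * The block subshift *)

Section BlockSubshift.
Variable D : nat.
Local Notation state := (state D).
Local Notation h := (h D).

Definition language_set : set (full_shift state) := [set x | in_language x].

Lemma language_set_closed : closed language_set.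
Proof.
move=> x clx z N.
have [y [yl xy]] := clx _ (nbhs_agree (`|z| + N)%N x).
have [k [b [p [pN yE]]]] := yl z N; exists k, b, p; split=> // j jN.
by rewrite -yE // xy //; lia.
Qed.

Lemma language_set_shift : @Defs.shift state @` language_set = language_set.
Proof.
apply/seteqP; split=> [_ [x xl <-] z N|x xl].
  have [k [b [p [pN xE]]]] := xl (z + 1) N; exists k, b, p; split=> // j jN.
  by rewrite -xE // /Defs.shift; congr x; lia.
exists (fun z => x (z - 1)); last by apply/funext => z;
  rewrite /Defs.shift addrK.
move=> z N; have [k [b [p [pN xE]]]] := xl (z - 1) N.
by exists k, b, p; split=> // j jN; rewrite -xE //; congr x; lia.
Qed.

Lemma language_set_nonempty : language_set !=set0.
Proof. by exists (block_point 0 (0, 0) : full_shift state);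
  apply: block_point_in_language. Qed.

Definition block_subshift : subshift state :=
  Subshift language_set_closed language_set_shift language_set_nonempty.

Local Notation X := block_subshift.
Local Notation T := (subshift_space X).
Local Notation f := (@subshift_map state X).

Lemma val_in_language (x : T) : in_language (set_val x).
Proof. exact: set_valP. Qed.

Lemma block_subshift_minimal : minimal f.
Proof.
move=> x O [y Oy] oO.
have [F FL OF] := open_bigcup_local oO; move: Oy; rewrite OF => -[L _ FLy].
have [k [b [p [pN yE]]]] := val_in_language y (- L%:Z) (2 * L).+1.
(* Somewhere to the right of the origin [x] shows a full block of level [k.+1], and this contains
   every level-[k] block, in particular the one that covers the window of [y]. *)
have [j [b' xE]] := in_language_block k.+1 0 (val_in_language x).
have [p' p'h WE] := block_word_primitive k b b'.
pose n := (j + p' + p + L)%N.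
exists (iter n f x); split; last by exists n; left.
exists L => //; apply: (FL L y) FLy => z zL.
rewrite iter_shiftE.
have [t tL Et] : exists2 t, (t < (2 * L).+1)%N & z = - L%:Z + t%:Z.
  by exists (absz (z + L%:Z)); lia.
rewrite Et yE // -WE; last by lia.
rewrite -xE; last by lia.
by congr (set_val x _); rewrite /n; lia.
Qed.

Lemma complexity_bound k :
  (complexity X (h k) <= #|state| * #|state| * h k)%N.
Proof.
pose word (u : state * state * 'I_(h k)) : (h k).-tuple state :=
  [tuple if (u.2 + j < h k)%N then block_word k u.1.1 (u.2 + j)
         else block_word k u.1.2 (u.2 + j - h k) | j < h k].
rewrite -!card_prod -[in leqRHS](card_ord (h k)) -card_prod.
apply: leq_trans (leq_imset_card word _).
apply: subset_leq_card; apply/fintype.subsetP => w;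
  rewrite inE => /asboolP[x Xx [z wx]].
have [r [b [b' [rh xE]]]] := in_language_two_blocks k z Xx.
apply/imsetP; exists (b, b', Ordinal rh) => //.
by apply: eq_from_tnth => j; rewrite -wx tnth_mktuple /= xE.
Qed.

Lemma block_subshift_complexity (R : realType) : ~ superlinear_complexity R X.
Proof.
rewrite /superlinear_complexity => E.
have /lt_limn_einf[k0 Hk0] : ((#|state| * #|state|)%:R%:E <
    limn_einf (fun n => ((complexity X n)%:R / n%:R : R)%:E))%E
  by rewrite E ltry.
have := Hk0 (h k0) (ltnW (ltn_h D k0)); rewrite lte_fin ltNge => /negP; apply.
rewrite ler_pdivrMr ?ltr0n ?h_gt0 // -natrM ler_nat; exact: complexity_bound.
Qed.

End BlockSubshift.

Lemma sum_interval N a b : (\sum_(n < N) (a <= n < b) <= minn N b - a)%N.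
Proof.
elim: N => [|N IH]; first by rewrite big_ord0.
by rewrite big_ord_recr /=; move: IH; set S := bigop _ _ _; lia.
Qed.

(** The tail after [k] is at most 2 c / 2 ^ k, so the lower envelope [v] increases, the upper
    envelope [w] decreases, and the supremum of [v] lies between them. *)
Lemma geometric_cauchy (R : realType) (u : R^nat) (c : R) :
  (forall k, `|u k.+1 - u k| <= c / 2 ^+ k) ->
  exists l, forall k, `|u k - l| <= 2 * c / 2 ^+ k.
Proof.
move=> uc; pose v k := u k - 2 * c / 2 ^+ k; pose w k := u k + 2 * c / 2 ^+ k.
have half k : 2 * c / 2 ^+ k = c / 2 ^+ k + 2 * c / 2 ^+ k.+1.
  by rewrite exprS; field; rewrite expf_neq0.
have c0 k : 0 <= c / 2 ^+ k by apply: le_trans (uc k).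
have vS k : v k <= v k.+1.
  by have := uc k; rewrite ler_norml /v (half k) => /andP[]; lra.
have wS k : w k.+1 <= w k.
  by have := uc k; rewrite ler_norml /w (half k) => /andP[]; lra.
have vle : {homo v : j k / (j <= k)%N >-> j <= k}.
  by apply: homo_leq => //; apply: le_trans.
have wge : {homo w : j k / (j <= k)%N >-> k <= j}.
  by apply: (homo_leq (r := fun a b => b <= a)) => // a b d ab da;
    apply: le_trans da ab.
have vw j k : v j <= w k.
  apply: (@le_trans _ _ (v (maxn j k))); first by rewrite vle ?leq_maxl.
  apply: (@le_trans _ _ (w (maxn j k))); last by rewrite wge ?leq_maxr.
  by rewrite /v /w; have := c0 (maxn j k); lra.
exists (sup (range v)) => k.
have v_sup : v k <= sup (range v).
  apply: ub_le_sup; last by exists k.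
  by exists (w 0) => _ [j _ <-].
have sup_w : sup (range v) <= w k.
  by apply: ge_sup => [|_ [j _ <-]] //; exists (v 0); exists 0.
by rewrite ler_norml; move: v_sup sup_w; rewrite /v /w; lra.
Qed.

(** * Counting visits along orbit segments *)

Section Counts.
Variables (A : finType) (X : subshift A).
Local Notation T := (subshift_space X).
Local Notation f := (@subshift_map A X).
Implicit Types (x y : T) (C : set T).

Definition visit_count C x N : nat := (\sum_(n < N) `[< C (iter n f x) >])%N.

Definition agree_on N x y :=
  forall j, (j < N)%N -> set_val x j%:Z = set_val y j%:Z.

Lemma visit_count_le C x N : (visit_count C x N <= N)%N.
Proof.
rewrite -[leqRHS]muln1 -[leqRHS]sum_ord_const.
by apply: leq_sum => n _; apply: leq_b1.
Qed.

Lemma visit_countT x N : visit_count setT x N = N.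
Proof.
rewrite /visit_count (eq_bigr (fun=> 1%N)) ?sum_ord_const ?muln1 // => n _.
by rewrite asboolT.
Qed.

Lemma visit_countU C C' x N : C `&` C' = set0 ->
  visit_count (C `|` C') x N = (visit_count C x N + visit_count C' x N)%N.
Proof.
move=> CC'; rewrite -big_split; apply: eq_bigr => n _ /=.
rewrite asbool_or; have := asboolP (C (iter n f x)).
case: asboolP => // Cn _; case: asboolP => // C'n.
by have : (C `&` C') (iter n f x) by []; rewrite CC'.
Qed.

Lemma visit_countD C x M N : visit_count C x (M + N) =
  (visit_count C x M + visit_count C (iter M f x) N)%N.
Proof.
rewrite /visit_count big_split_ord; congr addn; apply: eq_bigr => n _ /=.
by rewrite addnC iterD.
Qed.

Lemma visit_countM C x M N :
  visit_count C x (M * N) = (\sum_(j < M) visit_count C (iter (j * N) f x) N)%N.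
Proof.
rewrite /visit_count (sum_ord_mul _ _ (fun n => nat_of_bool `[< C (iter n f x)
  >])).
by apply: eq_bigr => j _; apply: eq_bigr => n _; rewrite addnC iterD.
Qed.

Lemma visit_count_shift C x N :
  (visit_count (f @^-1` C) x N + `[< C x >] =
    visit_count C x N + `[< C (iter N f x) >])%N.
Proof.
rewrite addnC [RHS]addnC.
have -> : (`[< C (iter N f x) >] + visit_count C x N)%N = visit_count C x N.+1.
  by rewrite /visit_count big_ord_recr addnC.
by rewrite /visit_count big_ord_recl.
Qed.

Lemma visit_count_iter C x m N : (visit_count C (iter m f x) N <=
  visit_count C x N + m)%N /\
  (visit_count C x N <= visit_count C (iter m f x) N + m)%N.
Proof.
have := visit_countD C x m N; rewrite addnC visit_countD => E.
have := visit_count_le C x m; have := visit_count_le C (iter N f x) m; lia.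
Qed.

Lemma boundary_count L N :
  (\sum_(n < N) ((0 <= n < L) + (N - L <= n < N)) <= 2 * L)%N.
Proof.
rewrite big_split /=; have := sum_interval N 0 L;
  have := sum_interval N (N - L) N.
by set a := bigop _ _ _; set b := bigop _ _ _; lia.
Qed.

Lemma agree_on_iter L N n x y : agree_on N x y -> (L <= n)%N -> (n < N - L)%N ->
  agree L (set_val (iter n f x)) (set_val (iter n f y)).
Proof.
move=> xy Ln nN z zL; rewrite !iter_shiftE.
have -> : z + n%:Z = (absz (z + n%:Z))%:Z by lia.
apply: xy; lia.
Qed.

(** At distance [L] from both ends, the window that decides membership in [C] lies in the common
    word; at most [2 * L] times remain. *)
Lemma visit_count_agree L C N x y : local_set L C -> agree_on N x y ->
  (visit_count C x N <= visit_count C y N + 2 * L)%N.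
Proof.
move=> CL xy; apply: leq_trans (leq_add (leqnn _) (boundary_count L N)).
rewrite -big_split; apply: leq_sum => n _ /=.
have nN := ltn_ord n.
have [nL|Ln] := ltnP n L; first by rewrite (leq_trans (leq_b1 _)) // addnCA
  leq_addr.
have [nNL|NLn] := ltnP n (N - L); last first.
  by rewrite nN (leq_trans (leq_b1 _)) // addnA leq_addl.
rewrite !addn0; case: asboolP => // Cx; rewrite asboolT //.
by apply: CL Cx; apply: agree_on_iter xy Ln nNL.
Qed.

(** Away from the two ends, a visit to [C] repeats [m] steps later, because the deciding windows
    coincide. *)
Lemma visit_count_return_agree L C N m x : local_set L C ->
  agree_on N x (iter m f x) -> (visit_count C x N <=
    visit_count (return_set m C) x N + 2 * L)%N.
Proof.
move=> CL xy; apply: leq_trans (leq_add (leqnn _) (boundary_count L N)).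
rewrite -big_split; apply: leq_sum => n _ /=.
have nN := ltn_ord n.
have [nL|Ln] := ltnP n L; first by rewrite (leq_trans (leq_b1 _)) // addnCA
  leq_addr.
have [nNL|NLn] := ltnP n (N - L); last first.
  by rewrite nN (leq_trans (leq_b1 _)) // addnA leq_addl.
rewrite !addn0; case: asboolP => // Cx; rewrite asboolT //; split=> //=.
rewrite -iterD addnC iterD.
by apply: CL Cx; apply: agree_on_iter xy Ln nNL.
Qed.

End Counts.

(** * The measure carried by a type *)

Section Frequencies.
Variables (R : realType) (D : nat).
Local Notation state := (state D).
Local Notation h := (h D).
Local Notation q := (q D).
Local Notation Q := (Q D).
Local Notation X := (block_subshift D).
Local Notation T := (subshift_space X).
Local Notation f := (@subshift_map state X).
Implicit Types (x y : T) (C : set T) (i : 'I_D.+1) (l : 'Z_4).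

Definition base_point k (b : state) : T :=
  exist _ (block_point k b : full_shift state)
    (mem_set (@block_point_in_language D k b)).

Lemma base_pointE k b (y : nat) : (y < h k)%N ->
  set_val (base_point k b) y%:Z = block_word k b y.
Proof. exact: block_point_block. Qed.

Lemma base_point_agree k n b P : (P < Q k n)%N ->
  agree_on (h k) (iter (P * h k) f (base_point (k + n) b)) (base_point k
    (descend k n b P)).
Proof.
move=> PQ y yh; have lt_h : (P * h k + y < h (k + n))%N.
  rewrite hD mulnC; apply: (@leq_trans (h k * P.+1)%N).
    by rewrite mulnS mulnC addnC ltn_add2r.
  by rewrite leq_mul2l PQ orbT.
by rewrite iter_shiftE -PoszD [(y + _)%N]addnC !base_pointE // block_word_block.
Qed.

Definition visits C k b := visit_count C (base_point k b) (h k).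

Lemma block_visits L C k n b P : local_set L C -> (P < Q k n)%N ->
  let c := visit_count C (iter (P * h k) f (base_point (k + n) b)) (h k) in
  (c <= visits C k (descend k n b P) + 2 * L)%N /\
  (visits C k (descend k n b P) <= c + 2 * L)%N.
Proof.
move=> CL PQ /=; have ag := base_point_agree b PQ.
split; apply: visit_count_agree CL _ => //.
by move=> j jh; rewrite ag.
Qed.

Lemma visits_blocks C k n b : visits C (k + n) b =
  (\sum_(P < Q k n)
     visit_count C (iter (P * h k) f (base_point (k + n) b)) (h k))%N.
Proof. by rewrite /visits hD mulnC visit_countM. Qed.

Lemma visits_le C k b : (visits C k b <= h k)%N.
Proof. exact: visit_count_le. Qed.

(** Cut the block into level-[k] blocks: the ends of each cost at most [2 * L], a change of type at
    most [h k], and the labels of the others are equidistributed. The factor 4 clears the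
    denominator of the mean over labels. *)
Lemma visits_step L C k i l : local_set L C ->
  let a := (q k * \sum_(l' : 'Z_4) visits C k (i, l'))%N in
  let e := (8 * L * q k + 4 * (8 ^ (2 * D.+1) * h k))%N in
  (visits C k.+1 (i, l) * 4 <= a + e)%N /\ (a <=
    visits C k.+1 (i, l) * 4 + e)%N.
Proof.
move=> CL a e.
pose S := (\sum_(P < q k) visits C k (i,
  (l + digit_sum (len D k - i.+1) (P %/ run i)%N)%R))%N.
have Sa : (S * 4 = a)%N by apply: (substitution_balanced k i l (fun l' => visits
  C k (i, l'))).
have t0 P : type_shift D k P = 0%N ->
    substitution k (i, l) P = (i, (l + digit_sum (len D k - i.+1) (P %/ run
      i)%N)%R).
  move=> tP; rewrite /substitution tP /=; congr (_, _).
  by rewrite (_ : inord 0 = 0) ?addr0 //; apply/val_inj; rewrite /= inordK.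
have Q1 : Q k 1 = q k by rewrite /= muln1.
have := visits_blocks C k 1 (i, l); rewrite addn1 Q1.
set c := visits C k.+1 (i, l) => Ec.
have bnd (P : 'I_(q k)) :
    (visit_count C (iter (P * h k) f (base_point k.+1 (i, l))) (h k) <=
      visits C k (i, (l + digit_sum (len D k - i.+1) (P %/ run i)%N)%R) +
        (2 * L + (type_shift D k P != 0%N) * h k))%N /\
    (visits C k (i, (l + digit_sum (len D k - i.+1) (P %/ run i)%N)%R) <=
      visit_count C (iter (P * h k) f (base_point k.+1 (i, l))) (h k) +
        (2 * L + (type_shift D k P != 0%N) * h k))%N.
  have PQ : (P < Q k 1)%N by rewrite Q1.
  have := block_visits (i, l) CL PQ; rewrite addn1 [descend _ _ _ _]/=.
  have [/t0 ->|tP] := eqVneq (type_shift D k P) 0%N; first by rewrite addn0.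
  have := visit_count_le C (iter (P * h k) f (base_point k.+1 (i, l))) (h k).
  have := visits_le C k (i, (l + digit_sum (len D k - i.+1) (P %/ run i)%N)%R).
  by rewrite mul1n; lia.
have tc := type_shift_count D k.
have err : (\sum_(P < q k) (2 * L + (type_shift D k P != 0%N) * h k) <=
    2 * L * q k + 8 ^ (2 * D.+1) * h k)%N.
  rewrite big_split /= sum_ord_const -big_distrl /= mulnC leq_add2l.
  by rewrite leq_mul2r tc orbT.
have c_le : (c <= S + (2 * L * q k + 8 ^ (2 * D.+1) * h k))%N.
  rewrite Ec; apply: leq_trans (leq_add (leqnn _) err).
  by rewrite -big_split; apply: leq_sum => P _; case: (bnd P).
have S_le : (S <= c + (2 * L * q k + 8 ^ (2 * D.+1) * h k))%N.
  rewrite Ec; apply: leq_trans (leq_add (leqnn _) err).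
  by rewrite -big_split; apply: leq_sum => P _; case: (bnd P).
rewrite /e -Sa; move: c_le S_le; rewrite -[(8 * L)%N]/((4 * 2) * L)%N -!mulnA.
move: (L * q k)%N (_ * h k)%N => u w; lia.
Qed.

Definition freq C k b : R := (visits C k b)%:R / (h k)%:R.

(** Every frequency of type [i] at level [k.+1] is close to this one number, whatever the label;
    hence the common limit. *)
Definition mean_freq C k i : R := (\sum_(l : 'Z_4) freq C k (i, l)) / 4.

Lemma h_gt0R k : 0 < (h k)%:R :> R.
Proof. by rewrite ltr0n h_gt0. Qed.

Lemma exp2_le_h k : 2 ^+ k <= (h k)%:R :> R.
Proof.
rewrite -natrX ler_nat; apply: leq_trans (leq_exp_h D k).
by rewrite -[8%N]/(2 * 4)%N expnMn leq_pmulr // expn_gt0.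
Qed.

Lemma freq_step L C k i l : local_set L C ->
  `|freq C k.+1 (i, l) - mean_freq C k i| <= (2 * L%:R + 1) / 2 ^+ k.
Proof.
move=> CL; have [] := @visits_step L C k i l CL.
pose a : R := (\sum_(l' : 'Z_4) visits C k (i, l'))%N%:R.
rewrite -!(ler_nat R) !(natrD, natrM) -/a => h1 h2.
have hk := h_gt0R k; have hk2 := exp2_le_h k.
have qk : 0 < (q k)%:R :> R by rewrite ltr0n q_gt0.
have Ef : freq C k.+1 (i, l) = (visits C k.+1 (i,
  l))%:R / ((h k)%:R * (q k)%:R).
  by rewrite /freq hS natrM.
have Em : mean_freq C k i = a / ((h k)%:R * 4).
  by rewrite /a natr_sum /mean_freq /freq -mulr_suml invfM mulrA.
set c := (visits _ _ _)%:R in h1 h2 Ef.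
have Ed : freq C k.+1 (i, l) - mean_freq C k i =
    (c * 4 - (q k)%:R * a) / ((h k)%:R * (q k)%:R * 4).
  by rewrite Ef Em; field; rewrite ?lt0r_neq0.
have q8 : 8 ^+ (2 * D.+1) * 2 ^+ k <= (q k)%:R :> R.
  rewrite -!natrX -natrM ler_nat /q /len.
  rewrite (_ : 3 * D.+1 + k + 3 = 2 * D.+1 + (k + (D.+1 + 3)))%N; last by lia.
  rewrite expnD leq_mul2l expnD; apply/orP; right.
  rewrite -[leqLHS]muln1 leq_mul ?expn_gt0 //.
  by rewrite -[8%N]/(2 * 4)%N expnMn leq_pmulr // expn_gt0.
have two_k : 0 < 2 ^+ k :> R by rewrite exprn_gt0.
have den0 : 0 < (h k)%:R * (q k)%:R * 4 :> R by rewrite !mulr_gt0.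
rewrite Ed normrM normfV (gtr0_norm den0) ler_pdivrMr //.
apply: (@le_trans _ _ (8 * L%:R * (q k)%:R + 4 * (8 ^+ (2 * D.+1) * (h k)%:R))).
  by rewrite ler_norml natrX in h1 h2 *; apply/andP; split; lra.
have -> : (2 * L%:R + 1) / 2 ^+ k * ((h k)%:R * (q k)%:R * 4) =
  8 * L%:R * (q k)%:R * ((h k)%:R / 2 ^+ k) +
    4 * ((q k)%:R / 2 ^+ k * (h k)%:R) :> R.
  by field; rewrite lt0r_neq0.
apply: lerD.
  by rewrite -{1}[_ * (q k)%:R]mulr1 ler_wpM2l ?mulr_ge0 ?ler0n // ler_pdivlMr
    // mul1r.
by rewrite ler_pM2l // ler_pM2r // ler_pdivlMr.
Qed.

Lemma freq_cvg C i : clopens C -> exists t : R, forall e : R, 0 < e ->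
  exists k0, forall k l, (k0 <= k)%N -> `|freq C k (i, l) - t| <= e.
Proof.
move=> [L CL]; pose c : R := 2 * L%:R + 1.
have s4 (r : R) : \sum_(l : 'Z_4) r = r * 4.
  by rewrite sumr_const card_ord -[LHS]mulr_natr.
have mstep k : `|mean_freq C k.+1 i - mean_freq C k i| <= c / 2 ^+ k.
  have -> : mean_freq C k.+1 i - mean_freq C k i =
      (\sum_(l : 'Z_4) (freq C k.+1 (i, l) - mean_freq C k i)) / 4.
    by rewrite sumrB s4 /mean_freq; field.
  rewrite normrM [`|4^-1|]ger0_norm ?invr_ge0 // ler_pdivrMr //.
  apply: le_trans (ler_norm_sum _ _ _) _.
  by rewrite -s4; apply: ler_sum => l _; apply: freq_step.
have [t Ht] := geometric_cauchy mstep; exists t => e e0.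
have c0 : 0 <= c by rewrite /c addr_ge0 // mulr_ge0.
(* Of the 3, two come from the distance of the mean to its limit and one from [freq_step]. *)
have [k1 Hk1] : exists k1, forall k, (k1 <= k)%N -> 3 * c / 2 ^+ k <= e.
  have [k1 Hk1] : exists k1 : nat, 3 * c / e <= k1%:R.
    by exists (Num.truncn (3 * c / e)).+1; rewrite ltW // truncnS_gt.
  exists k1 => k kk; rewrite ler_pdivrMr ?exprn_gt0 // [e * _]mulrC -ler_pdivrMr
    //.
  apply: le_trans Hk1 _; apply: (@le_trans _ _ k%:R); first by rewrite ler_nat.
  by rewrite -natrX ler_nat ltnW // ltn_expl.
exists k1.+1 => -[//|k] l; rewrite ltnS => /Hk1 kk.
have := @freq_step L C k i l CL; have := Ht k; rewrite -/c.
have -> : freq C k.+1 (i, l) - t =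
  (freq C k.+1 (i, l) - mean_freq C k i) + (mean_freq C k i - t) by ring.
move=> h1 h2; apply: le_trans (ler_normD _ _) _.
by apply: le_trans (lerD h2 h1) _; apply: le_trans kk; lra.
Qed.

(** [mu] is the limit of the empirical measures of the blocks of type [i], uniformly in the label.
    All later properties of [mu] are derived from this. *)
Definition generic i (mu : probability (borel X) R) :=
  forall C, clopens C -> forall e : R, 0 < e ->
  exists k0, forall k l, (k0 <= k)%N -> `|freq C k (i, l) - prob mu C| <= e.

Lemma limit_unique (a b c : R) :
  (forall e : R, 0 < e -> `|a - b| <= c * e) -> a = b.
Proof.
move=> H; apply/eqP; rewrite -subr_eq0 -normr_le0; apply/ler_addgt0Pr => e e0.
rewrite add0r; have d0 : 0 < `|c| + 1 by have := normr_ge0 c; lra.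
apply: le_trans (H (e / (`|c| + 1)) _) _; first by rewrite divr_gt0.
rewrite mulrA ler_pdivrMr // mulrC ler_wpM2l ?ltW //.
by have := ler_norm c; lra.
Qed.

Lemma exists_generic i : exists mu, generic i mu.
Proof.
have /choice[t Ht] : forall C, exists t : R, clopens C -> forall e : R, 0 < e ->
    exists k0, forall k l, (k0 <= k)%N -> `|freq C k (i, l) - t| <= e.
  move=> C; have [CC|nCC] := pselect (clopens C); last by exists 0.
  by have [t Ht] := freq_cvg i CC; exists t.
have t_ge0 C : clopens C -> 0 <= t C.
  move=> CC; apply/ler_addgt0Pr => e e0; have [k0 Hk0] := Ht C CC e e0.
  have := Hk0 k0 0 (leqnn _); rewrite ler_norml => /andP[_].
  have : 0 <= freq C k0 (i, 0) by rewrite divr_ge0.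
  by lra.
have tT : t setT = 1.
  apply: (@limit_unique _ _ 1) => e e0.
  have [k0 Hk0] := Ht setT (@clopensT _ _) e e0.
  have := Hk0 k0 0 (leqnn _); rewrite /freq /visits visit_countT divff
    ?lt0r_neq0 ?h_gt0R //.
  by rewrite distrC mul1r.
have t_add C C' : clopens C -> clopens C' -> C `&` C' = set0 ->
    t (C `|` C') = t C + t C'.
  move=> CC CC' dis; apply: (@limit_unique _ _ 3) => e e0.
  have [k0 Hk0] := Ht C CC e e0; have [k1 Hk1] := Ht C' CC' e e0.
  have [k2 Hk2] := Ht _ (clopensU CC CC') e e0.
  pose k := maxn k0 (maxn k1 k2).
  have := Hk0 k 0 (leq_maxl _ _); have := Hk1 k 0; have := Hk2 k 0.
  move=> /(_ ltac:(by rewrite /k; lia)) a2 /(_ ltac:(by rewrite /k; lia)) a1 a0.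
  have E : freq (C `|` C') k (i, 0) = freq C k (i, 0) + freq C' k (i, 0).
    by rewrite /freq /visits visit_countU // natrD mulrDl.
  by move: a0 a1 a2; rewrite E !ler_norml => /andP[? ?] /andP[? ?] /andP[? ?];
    apply/andP; split; lra.
have [mu Hmu] := exists_extension t_ge0 tT t_add.
by exists mu => C CC e e0; rewrite /prob Hmu //=; apply: Ht.
Qed.

End Frequencies.

(** * Invariance and the lower bound for the rate *)

Section GenericMeasure.
Variables (R : realType) (D : nat).
Local Notation state := (state D).
Local Notation h := (h D).
Local Notation q := (q D).
Local Notation Q := (Q D).
Local Notation X := (block_subshift D).
Local Notation T := (subshift_space X).
Local Notation f := (@subshift_map state X).
Implicit Types (x y : T) (C : set T) (l : 'Z_4).

Variables (i : 'I_D.+1) (mu : probability (borel X) R).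
Hypothesis mu_generic : generic i mu.
Local Notation pr := (prob mu).

Lemma eventually_natr (M : R) : exists k0, forall k, (k0 <= k)%N -> M <= k%:R.
Proof.
exists (Num.truncn M).+1 => k kk; apply: (@le_trans _ _ (Num.truncn M).+1%:R).
  by rewrite ltW // truncnS_gt.
by rewrite ler_nat.
Qed.

Lemma ltn_Q k n : (n < Q k n)%N.
Proof.
elim: n k => [|n IH] k //=; have := IH k.+1; have := leq_8_q D k.
move: (q k) (Q _ _) => a b; nia.
Qed.

Lemma generic_invariant C : clopens C -> mu (f @^-1` C : set (borel X)) = mu C.
Proof.
move=> CC; have CfC := clopens_shift CC.
rewrite !prE; try exact: clopen_measurable.
congr (_%:E); apply: (@limit_unique _ _ _ 3) => e e0.
have [k0 Hk0] := mu_generic CC e0; have [k1 Hk1] := mu_generic CfC e0.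
have [k2 Hk2] := eventually_natr e^-1.
pose k := maxn k0 (maxn k1 k2).
have a0 := Hk0 k 0 (leq_maxl _ _).
have a1 : `|freq R (f @^-1` C) k (i, 0) - pr (f @^-1` C)| <= e.
  by apply: Hk1; rewrite /k; lia.
have hk : e^-1 <= (h k)%:R.
  apply: le_trans (Hk2 k _) _; first by rewrite /k; lia.
  by rewrite ler_nat ltnW // ltn_h.
have a2 : `|freq R (f @^-1` C) k (i, 0) - freq R C k (i, 0)| <= e.
  rewrite /freq -mulrBl normrM normfV (gtr0_norm (h_gt0R R D k)).
  rewrite ler_pdivrMr ?h_gt0R //; apply: (@le_trans _ _ 1); last first.
    by rewrite -ler_pdivrMl // mulr1.
  have := visit_count_shift C (base_point k (i, 0)) (h k);
    rewrite -!/(visits _ _ _).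
  move=> /(congr1 (fun n => n%:R : R)); rewrite !natrD ler_norml.
  by case: asboolP => _; case: asboolP => _ /=; lra.
by move: a0 a1 a2; rewrite !ler_norml => /andP[? ?] /andP[? ?] /andP[? ?]; lra.
Qed.

Lemma bad_le k n : (bad D k n)%:R <= 2 / 8 ^+ (D.+1 + k + 3) * (Q k n)%:R :> R.
Proof.
have := bad_count D k n; rewrite -/(bad D k n) -(ler_nat R) !natrM natrX => H.
by rewrite mulrAC ler_pdivlMr ?exprn_gt0.
Qed.

Lemma bad_le_level k n : 2 * (bad D k n)%:R <= 4 / 8 ^+ k * (Q k n)%:R :> R.
Proof.
apply: (@le_trans _ _ (2 * (2 / 8 ^+ (D.+1 + k + 3) * (Q k n)%:R))).
  by rewrite ler_pM2l ?bad_le.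
rewrite !mulrA -natrM ler_wpM2r ?ler0n // ler_wpM2l // lef_pV2 ?posrE ?exprn_gt0
  //.
by rewrite ler_eXn2l ?ltr1n //; lia.
Qed.

Lemma exp8_small (e : R) : 0 < e -> exists k0, forall k, (k0 <= k)%N ->
  5 / 8 ^+ k <= e.
Proof.
move=> e0; have [k0 Hk0] := eventually_natr (5 / e); exists k0 => k /Hk0 Hk.
rewrite ler_pdivrMr ?exprn_gt0 // [e * _]mulrC -ler_pdivrMr //.
by apply: le_trans Hk _; rewrite -natrX ler_nat ltnW // ltn_expl.
Qed.

Definition rate_value : R := 1 - (run i)%:R^-1.

Lemma run_gt0R : 0 < (run i)%:R :> R.
Proof. by rewrite ltr0n expn_gt0. Qed.

(** [label_pattern_matches_one] supplies [rate_value]; the term with 4 / 8 ^ k pays for the changes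
    of type, and the final 1 for the last block, which has no successor inside. *)
Lemma stay_count k n :
  rate_value * (Q k n.+1)%:R - 4 / 8 ^+ k * (Q k n.+1)%:R - 1 <=
  (\sum_(P < Q k n.+1) [&& keeps_type D k n.+1 P,
     descend k n.+1 (i, 0%R) P == descend k n.+1 (i,
       0%R) P.+1 & (P.+1 < Q k n.+1)%N])%N%:R.
Proof.
set S := (\sum_(_ < _) _)%N.
have H1 := label_pattern_matches_one i k n;
  have H2 := descend_matches i 0 k n.+1 1.
have H3 : (\sum_(P < Q k n.+1) (keeps_type D k n.+1 P &&
      (descend k n.+1 (i, 0%R) P == descend k n.+1 (i, 0%R) (P + 1)%N)) <=
        S + 1)%N.
  have := sum_interval (Q k n.+1) (Q k n.+1).-1 (Q k n.+1).
  have Qpos := Q_gt0 D k n.+1.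
  rewrite minnn (_ : Q k n.+1 - (Q k n.+1).-1 = 1)%N; last by lia.
  move=> H; apply: leq_trans (leq_add (leqnn _) H).
  rewrite -big_split; apply: leq_sum => P _ /=; rewrite addn1.
  case: (keeps_type _ _ _ _) => //=; case: (_ == _) => //=.
  have := ltn_ord P; case: ltnP => // PQ; lia.
have H4 : ((run i).-1 * (8 ^ depth i k * Q k.+1 n) <=
  S + 1 + 2 * bad D k n.+1)%N.
  by apply: leq_trans H1 (leq_trans H2 _); rewrite leq_add2r.
have EQ : Q k n.+1 = (run i * (8 ^ depth i k * Q k.+1 n))%N.
  by rewrite [LHS]/= (q_depth i) mulnA.
have Erun : (run i).-1%:R = (run i)%:R - 1 :> R.
  by rewrite -subn1 natrB // expn_gt0.
have HB := bad_le_level k n.+1.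
have H5 : ((run i)%:R - 1) * ((8 ^ depth i k)%:R * (Q k.+1 n)%:R) <=
    S%:R + 1%:R + 2%:R * (bad D k n.+1)%:R :> R.
  by rewrite -Erun -!(natrM, natrD) ler_nat.
have -> : rate_value * (Q k n.+1)%:R =
   ((run i)%:R - 1) * ((8 ^ depth i k)%:R * (Q k.+1 n)%:R).
  by rewrite EQ natrM natrM /rate_value; field; apply: lt0r_neq0 run_gt0R.
lra.
Qed.

Lemma block_near C (e : R) L k n P : local_set L C -> 0 < e ->
  (forall l, `|freq R C k (i, l) - pr C| <= e) -> 2 * L%:R <= e * (h k)%:R ->
  (P < Q k n)%N -> keeps_type D k n P ->
  `|(visit_count C (iter (P * h k) f (base_point (k + n) (i, 0))) (h k))%:R -
     (h k)%:R * pr C| <= 2 * e * (h k)%:R.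
Proof.
move=> CL e0 near Lh PQ gP; have := block_visits (i, 0) CL PQ.
rewrite keeps_type_descend //; set l := (0 + _); have := near l.
rewrite /freq; set c := visits _ _ _;
  set c' := visit_count _ _ _ => H [c'c cc'].
have hk := h_gt0R R D k.
have h1 : c'%:R <= c%:R + 2%:R * L%:R :> R by rewrite -natrM -natrD ler_nat.
have h2 : c%:R <= c'%:R + 2%:R * L%:R :> R by rewrite -natrM -natrD ler_nat.
have : `|c%:R - (h k)%:R * pr C| <= e * (h k)%:R.
  have -> : c%:R - (h k)%:R * pr C = (c%:R / (h k)%:R - pr C) * (h k)%:R.
    by field; apply: lt0r_neq0.
  by rewrite normrM (gtr0_norm hk) ler_pM2r.
by rewrite !ler_norml => /andP[? ?]; apply/andP; split; lra.
Qed.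

Lemma generic_rigid C (e : R) : clopens C -> 0 < e -> exists k0,
  forall k, (k0 <= k)%N -> rate_value * pr C - e <= pr (return_set (h k) C).
Proof.
move=> CC e0; have [L CL] := CC; pose e1 := e / 7.
have e1_gt0 : 0 < e1 by rewrite /e1; lra.
have Ee : e = 7 * e1 by rewrite /e1; field.
have [k0 Hk0] := mu_generic CC e1_gt0.
have [k1 Hk1] := eventually_natr (4 * L%:R / e1).
have [k2 Hk2] := exp8_small e1_gt0.
exists (maxn k0 (maxn k1 k2)) => k kk.
have near l : `|freq R C k (i, l) - pr C| <= e1 by apply: Hk0; lia.
have Lh : 4 * L%:R <= e1 * (h k)%:R.
  have : 4 * L%:R / e1 <= (h k)%:R.
    apply: le_trans (Hk1 k _) _; first by lia.
    by rewrite ler_nat ltnW // ltn_h.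
  by rewrite ler_pdivrMr // [e1 * _]mulrC.
have Lh2 : 2 * L%:R <= e1 * (h k)%:R.
  by apply: le_trans Lh; rewrite ler_wpM2r ?ler0n // ler_nat.
have k8 : 4 / 8 ^+ k <= e1.
  apply: le_trans (Hk2 k _); last by lia.
  by rewrite ler_wpM2r ?invr_ge0 ?exprn_ge0 // ler_nat.
have mC := clopen_measurable CC.
have a0 := pr_ge0 mu C; have a1 := pr_le1 mu mC.
have rv0 : 0 <= rate_value.
  by rewrite subr_ge0 invf_le1 ?run_gt0R // ler1n expn_gt0.
have rv1 : rate_value <= 1.
  by rewrite gerBl invr_ge0 ler0n.
(* For very small [pr C] the claim is trivial; otherwise the lower bound on the number of repeated
   blocks may be multiplied by the positive factor [pr C - 3 * e1]. *)
have [b0|b_gt0] := lerP (pr C - 3 * e1) 0.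
  have := pr_ge0 mu (return_set (h k) C).
  have : rate_value * pr C <= 1 * pr C by rewrite ler_wpM2r.
  by lra.
have CR : clopens (return_set (h k) C) by apply: clopensI => //;
  apply: clopens_iter.
have [K0 HK0] := mu_generic CR e1_gt0.
have [n0 Hn0] := eventually_natr e1^-1.
pose n := maxn K0 n0; pose K := (k + n.+1)%N.
have aK : `|freq R (return_set (h k) C) K (i,
  0) - pr (return_set (h k) C)| <= e1.
  by apply: HK0; rewrite /K /n; lia.
have Q1 : 1 <= e1 * (Q k n.+1)%:R.
  rewrite -ler_pdivrMl // mulr1; apply: le_trans (Hn0 n (leq_maxr _ _)) _.
  by rewrite ler_nat ltnW // (leq_trans _ (ltn_Q k n.+1)).
have Qpos : 0 < (Q k n.+1)%:R :> R by rewrite ltr0n Q_gt0.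
have hk := h_gt0R R D k.
set S := return_set (h k) C in CR aK HK0 *.
(* A block followed by one of the same state recurs after [h k] steps, so its visits to [C] are
   returns, up to boundary effects included in [3 * e1]. *)
have visit_count_ge : (\sum_(P < Q k n.+1) [&& keeps_type D k n.+1 P,
     descend k n.+1 (i, 0%R) P == descend k n.+1 (i,
       0%R) P.+1 & (P.+1 < Q k n.+1)%N])%N%:R *
     ((h k)%:R * (pr C - 3 * e1)) <= (visits S K (i, 0))%:R.
  rewrite /K visits_blocks !natr_sum mulr_suml; apply: ler_sum => P _.
  case: and3P => [[gP /eqP eqst PQ]|_]; last by rewrite mul0r.
  rewrite mul1r; have := block_near CL e1_gt0 near Lh2 (ltn_ord P) gP.
  set x := iter _ f _.
  have ag : agree_on (h k) x (iter (h k) f x).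
    rewrite /x -iterD -mulSn => j jh.
    rewrite (base_point_agree (i, 0) (ltn_ord P) jh).
    by rewrite (base_point_agree (i, 0) PQ jh) eqst.
  have := visit_count_return_agree CL ag; rewrite -/S.
  set c := visit_count C x _; set c' := visit_count S x _ => cc'.
  have h1 : c%:R <= c'%:R + 2%:R * L%:R :> R by rewrite -natrM -natrD ler_nat.
  move: h1; rewrite ler_norml => h1 /andP[h2 _]; lra.
have := stay_count k n.
set N := (\sum_(_ < _) _)%N%:R in visit_count_ge * => HN.
(* One [e1] in [2 * e1] pays for the changes of type, the other for the missing last block. The
   product costs at most five shares, the passage from frequency to measure a sixth. *)
have freq_ge : (rate_value - 2 * e1) * (pr C - 3 * e1) <= freq R S K (i, 0).
  rewrite /freq ler_pdivlMr ?h_gt0R //; apply: le_trans visit_count_ge.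
  rewrite /K hD natrM.
  have -> :
    (rate_value - 2 * e1) * (pr C - 3 * e1) * ((h k)%:R * (Q k n.+1)%:R) =
    ((rate_value - 2 * e1) * (Q k n.+1)%:R) * ((h k)%:R * (pr C - 3 * e1)).
    by ring.
  apply: ler_wpM2r; first by rewrite mulr_ge0 ?ltW.
  have : 4 / 8 ^+ k * (Q k n.+1)%:R <= e1 * (Q k n.+1)%:R by rewrite ler_pM2r.
  have -> : (rate_value - 2 * e1) * (Q k n.+1)%:R =
    rate_value * (Q k n.+1)%:R - 2 * (e1 * (Q k n.+1)%:R) by ring.
  move: HN Q1; clearbody N.
  move: (rate_value * _) (e1 * _) (4 / 8 ^+ k * _) => u v w; lra.
have h1 : rate_value * (3 * e1) <= 1 * (3 * e1) by rewrite ler_wpM2r //; lra.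
have h2 : e1 * pr C <= e1 * 1 by rewrite ler_pM2l.
have h3 : 0 <= e1 * e1 by rewrite mulr_ge0 ?ltW.
have E : (rate_value - 2 * e1) * (pr C - 3 * e1) =
  rate_value * pr C - rate_value * (3 * e1) - 2 * (e1 * pr C) + 6 * (e1 * e1) by
    ring.
rewrite E in freq_ge; move: aK; rewrite ler_norml => /andP[_ h4].
rewrite Ee; lra.
Qed.

End GenericMeasure.

(** * The rates and ergodicity *)

Section ReturnRate.
Variables (R : realType) (D : nat).
Local Notation state := (state D).
Local Notation h := (h D).
Local Notation q := (q D).
Local Notation Q := (Q D).
Local Notation X := (block_subshift D).
Local Notation T := (subshift_space X).
Local Notation f := (@subshift_map state X).
Implicit Types (x y : T) (C : set T) (l : 'Z_4).

Variables (i : 'I_D.+1) (mu : probability (borel X) R).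
Hypothesis mu_generic : generic i mu.
Local Notation pr := (prob mu).
Local Notation rate_value := (rate_value R i).

(** The last term counts the positions whose partner lies beyond the end of the block. *)
Lemma visits_match k n m :
  (visits (@match_set _ X (h k * m)) (k + n) (i, 0%R) <=
   h k * (matches (label_pattern i k n) m (Q k n) + 2 * bad D k n) + h k * m)%N.
Proof.
apply: leq_trans (leq_add (block_word_matches i 0 k n m) (leqnn _)).
set K := (k + n)%N; set lag := (h k * m)%N.
have := sum_interval (h K) (h K - lag) (h K); rewrite minnn => H.
have {}H : (\sum_(p < h K) (h K - lag <= p < h K) <= lag)%N by lia.
apply: leq_trans (leq_add (leqnn _) H); rewrite -big_split;
  apply: leq_sum => p _ /=.
have pK := ltn_ord p; rewrite pK andbT.
have [ple|plt] := leqP (h K - lag) p;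
  first by rewrite (leq_trans (leq_b1 _)) // leq_addl.
rewrite addn0; case: asboolP => // mp.
have : set_val (iter p f (base_point K (i, 0%R))) 0 =
    set_val (iter p f (base_point K (i, 0%R))) lag%:Z := mp.
rewrite !iter_shiftE add0r -PoszD base_pointE // base_pointE; last by lia.
by rewrite [(lag + _)%N]addnC => ->; rewrite eqxx.
Qed.

(** As [n] grows, the overhang [h k * m] becomes negligible against the block, and only the
    agreement of patterns remains. *)
Lemma pr_match_le k m (c : R) :
  (forall n, (2 * m <= Q k n.+1)%N ->
    (matches (label_pattern i k n.+1) m (Q k n.+1))%:R +
      2 * (bad D k n.+1)%:R <=
      c * (Q k n.+1)%:R) ->
  pr (@match_set _ X (h k * m)) <= c.
Proof.
move=> H; apply/ler_addgt0Pr => e e0; have e2 : 0 < e / 2 by lra.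
have [k0 Hk0] := mu_generic (@match_clopen _ X (h k * m)) e2.
have [n0 Hn0] := eventually_natr (m%:R / (e / 2)).
pose n := maxn k0 (maxn n0 (2 * m)); pose K := (k + n.+1)%N.
have nQ := ltn_Q D k n.+1.
have mQ : (2 * m <= Q k n.+1)%N by rewrite /n in nQ *; lia.
have := Hk0 K 0; rewrite /K /n => /(_ ltac:(lia)); rewrite -/n -/K.
have hk := h_gt0R R D k.
have Qpos : 0 < (Q k n.+1)%:R :> R by rewrite ltr0n Q_gt0.
have me : m%:R <= e / 2 * (Q k n.+1)%:R.
  rewrite [e / 2 * _]mulrC -ler_pdivrMr //; apply: le_trans (Hn0 n _) _.
    by rewrite /n; lia.
  by rewrite ler_nat ltnW // (leq_trans _ nQ).
have := visits_match k n.+1 m; set v := visits _ _ _ => hv.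
have {}hv : v%:R <= (h k)%:R * ((matches (label_pattern i k n.+1) m (Q k
  n.+1))%:R +
    2%:R * (bad D k n.+1)%:R) + (h k)%:R * m%:R :> R.
  by rewrite -!(natrM, natrD) ler_nat.
rewrite /freq -/v /K hD [(h k * _)%:R]natrM => near.
suff : v%:R / ((h k)%:R * (Q k n.+1)%:R) <= c + e / 2.
  by move: near; rewrite ler_norml => /andP[]; lra.
rewrite ler_pdivrMr ?mulr_gt0 // mulrCA; apply: le_trans hv _.
rewrite -mulrDr ler_pM2l // [leRHS]mulrDl.
by apply: lerD; [apply: H|apply: me].
Qed.

Lemma rate_value_large_lag k n m : (run i <= m)%N -> ~~ (q k %| m)%N ->
  (2 * m <= Q k n.+1)%N ->
  (matches (label_pattern i k n.+1) m (Q k n.+1))%:R + 2 * (bad D k n.+1)%:R <=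
    rate_value * (Q k n.+1)%:R.
Proof.
move=> im qm mQ; have L8 := leq_8_run i.
have /= H := label_pattern_matches_large_lag im qm mQ.
have Lpos := run_gt0R R i.
set M := matches _ _ _ in H *; set L := run i in L8 H Lpos *.
have HR : M%:R * (32%:R * L%:R) <= (32%:R * L%:R - 37%:R) * (Q k n.+1)%:R :> R.
  rewrite -natrM -natrM -natrB; last by lia.
  by rewrite -natrM ler_nat.
(* The summand [D.+1 + 3] of [len] is spent here, through 512 run i <= 8 ^ (D.+1 + k + 3); the
   resulting 1 / (128 run i) is well below the margin 5 / (32 run i). *)
have HB : 2 * (bad D k n.+1)%:R <= (Q k n.+1)%:R / (128 * L%:R) :> R.
  apply: (@le_trans _ _ (2 * (2 / 8 ^+ (D.+1 + k + 3) * (Q k n.+1)%:R))).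
    by rewrite ler_pM2l // bad_le.
  have Z0 : 0 < 8 ^+ (D.+1 + k + 3) :> R by rewrite exprn_gt0.
  have hZ : (512 * L)%:R <= 8 ^+ (D.+1 + k + 3) :> R.
    rewrite -natrX ler_nat /L /run -[512%N]/(8 ^ 3)%N -expnD leq_exp2l //.
    by have := ltn_ord i; lia.
  have {}hZ : 4 / 8 ^+ (D.+1 + k + 3) <= (128 * L%:R)^-1 :> R.
    rewrite ler_pdivrMr // mulrC ler_pdivlMr ?mulr_gt0 //.
    by rewrite natrM in hZ; lra.
  have -> : 2 * (2 / 8 ^+ (D.+1 + k + 3) * (Q k n.+1)%:R) =
    4 / 8 ^+ (D.+1 + k + 3) * (Q k n.+1)%:R :> R by ring.
  by rewrite [leRHS]mulrC; apply: ler_wpM2r.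
have -> : rate_value * (Q k n.+1)%:R =
   (Q k n.+1)%:R - (Q k n.+1)%:R / L%:R.
  by rewrite /rate_value -/L mulrBl mul1r mulrC.
have EM : M%:R <= (Q k n.+1)%:R - 37 / 32 * ((Q k n.+1)%:R / L%:R) :> R.
  rewrite -(ler_pM2r (_ : 0 < 32 * L%:R)) ?mulr_gt0 //; apply: le_trans HR _.
  rewrite le_eqVlt; apply/orP; left; apply/eqP; field; exact: lt0r_neq0.
have EB : (Q k n.+1)%:R / (128 * L%:R) = 1 / 128 * ((Q k n.+1)%:R / L%:R) :> R.
  by field; apply: lt0r_neq0.
have : 0 <= (Q k n.+1)%:R / L%:R :> R by rewrite divr_ge0.
rewrite EB in HB; move: ((Q k n.+1)%:R / L%:R) HB EM => w HB EM; lra.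
Qed.

Lemma rate_value_small_lag k n m : (0 < m < run i)%N ->
  (matches (label_pattern i k n.+1) m (Q k n.+1))%:R + 2 * (bad D k n.+1)%:R <=
    (rate_value + 5 / 8 ^+ k) * (Q k n.+1)%:R.
Proof.
move=> im; have H := @label_pattern_matches_small_lag D i k n m im.
set M := matches _ _ _ in H *; have Lpos := run_gt0R R i.
have EQ : Q k n.+1 = (run i * (8 ^ depth i k * Q k.+1 n))%N.
  by rewrite [LHS]/= (q_depth i) mulnA.
have EQ' : Q k n.+1 = (q k * Q k.+1 n)%N by [].
have HB := bad_le_level R D k n.+1.
have Erun : (run i).-1%:R = (run i)%:R - 1 :> R.
  by rewrite -subn1 natrB // expn_gt0.
have HR : M%:R <= ((run i)%:R - 1) * (8 ^ depth i k * Q k.+1 n)%:R + (Q k.+1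
  n)%:R :> R.
  by rewrite -Erun -natrM -natrD ler_nat.
have E1 : ((run i)%:R - 1) * (8 ^ depth i k * Q k.+1 n)%:R =
  rate_value * (Q k n.+1)%:R.
  by rewrite EQ [(run i * _)%:R]natrM /rate_value; field; apply: lt0r_neq0.
have E2 : (Q k.+1 n)%:R <= 1 / 8 ^+ k * (Q k n.+1)%:R :> R.
  rewrite EQ' [(q k * _)%:R]natrM mulrA -{1}[(Q k.+1 n)%:R]mul1r ler_wpM2r
    ?ler0n //.
  rewrite mul1r mulrC ler_pdivlMr ?exprn_gt0 // mul1r -natrX ler_nat.
  by rewrite leq_exp2l // /len; lia.
rewrite E1 in HR; rewrite [leRHS]mulrDl.
have -> : 5 / 8 ^+ k * (Q k n.+1)%:R =
  4 / 8 ^+ k * (Q k n.+1)%:R + 1 / 8 ^+ k * (Q k n.+1)%:R :> R by ring.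
move: HR HB E2; move: (rate_value * _) (4 / _ * _) (1 / _ * _) => u v w; lra.
Qed.

(** [k] is the largest level whose height divides the lag, found just before the first level where
    divisibility fails. *)
Lemma lag_decomposition lag : (0 < lag)%N -> exists k m,
  lag = (h k * m)%N /\ ~~ (q k %| m)%N.
Proof.
move=> lag0; have ex : exists k, ~~ (h k %| lag)%N.
  by exists lag; apply/negP => /(dvdn_leq lag0); rewrite leqNgt ltn_h.
case: (ex_minnP ex) => -[|k] nk kmin; first by rewrite /h /= dvd1n in nk.
have /dvdnP[m Em] : (h k %| lag)%N by apply: contraT => /kmin; rewrite ltnn.
exists k, m; split; first by rewrite Em mulnC.
by move: nk; rewrite hS Em [(m * _)%N]mulnC dvdn_pmul2l ?h_gt0.
Qed.

Lemma generic_match (e : R) : 0 < e -> exists k0, forall lag, (k0 <= lag)%N ->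
  pr (@match_set _ X lag) <= rate_value + e.
Proof.
move=> e0; have [k0 Hk0] := exp8_small e0; exists (h k0) => lag k0lag.
have lag0 : (0 < lag)%N := leq_trans (h_gt0 D k0) k0lag.
have [k [m [Elag qm]]] := lag_decomposition lag0.
have m0 : (0 < m)%N by move: lag0; rewrite Elag muln_gt0 => /andP[].
rewrite Elag; apply: pr_match_le => n mQ.
have [im|mi] := leqP (run i) m.
  apply: le_trans (rate_value_large_lag im qm mQ) _.
  by rewrite ler_wpM2r // lerDl ltW.
(* Here m < run i <= q k puts the lag below [h k.+1], so a large lag forces a large [k] and a small
   error 5 / 8 ^ k. *)
apply: le_trans (rate_value_small_lag k n _) _; first by rewrite m0.
rewrite ler_wpM2r // lerD2l; apply: Hk0.
rewrite -ltnS -(leqW_mono (leq_h D)) (leq_ltn_trans k0lag) // Elag hS ltn_pmul2l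
  ?h_gt0 //.
by rewrite (leq_trans mi) // (q_depth i) leq_pmulr // expn_gt0.
Qed.

End ReturnRate.

(** * Ergodicity from averages over windows of blocks *)

Section Ergodicity.
Variables (R : realType) (D : nat).
Local Notation state := (state D).
Local Notation h := (h D).
Local Notation q := (q D).
Local Notation Q := (Q D).
Local Notation X := (block_subshift D).
Local Notation T := (subshift_space X).
Local Notation f := (@subshift_map state X).
Implicit Types (x : T) (C : set T) (l : 'Z_4).

Variables (i : 'I_D.+1) (mu : probability (borel X) R).
Hypothesis mu_generic : generic i mu.
Local Notation pr := (prob mu).

(** Exchanging the sums counts, for each visit to [C], the visits during the [N] steps from it
    on. *)
Lemma visits_return C K N :
  (\sum_(m < N) visits (return_set m C) K (i, 0%R) =
   \sum_(p < h K) `[< C (iter p f (base_point K (i, 0%R))) >] *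
     visit_count C (iter p f (base_point K (i, 0%R))) N)%N.
Proof.
rewrite /visits /visit_count exchange_big; apply: eq_bigr => p _ /=.
rewrite big_distrr; apply: eq_bigr => m _ /=.
by rewrite /return_set asbool_and mulnb.
Qed.

(** Moving the start to a block boundary costs [h k]. Then each block that keeps the type has nearly
    the frequency [pr C], and each of the others, or one beyond the end of the large block, costs at
    most [h k]. *)
Lemma window_average C (e : R) L k n M P y :
  local_set L C -> 0 < e ->
  (forall l, `|freq R C k (i, l) - pr C| <= e) -> 2 * L%:R <= e * (h k)%:R ->
  (y < h k)%N ->
  `|(visit_count C (iter (P * h k + y) f (base_point (k + n) (i,
    0))) (M * h k))%:R -
     (M * h k)%:R * pr C| <= (h k)%:R + 2 * e * (M * h k)%:R +
     (h k)%:R * (\sum_(j < M) (~~ keeps_type D k n (P + j) + (Q k n <=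
       P + j)))%N%:R.
Proof.
move=> CL e0 near Lh yh; set z := base_point _ _; have hk := h_gt0R R D k.
have mC := clopen_measurable (ex_intro _ L CL : clopens C).
have a0 := pr_ge0 mu C; have a1 := pr_le1 mu mC.
have shift_y : `|(visit_count C (iter (P * h k + y) f z) (M * h k))%:R -
    (visit_count C (iter (P * h k) f z) (M * h k))%:R| <= (h k)%:R :> R.
  rewrite addnC iterD; 
  have [] := visit_count_iter C (iter (P * h k) f z) y (M * h k).
  set a := visit_count _ _ _; set b := visit_count _ _ _ => ab ba.
  have {}ab : a%:R <= b%:R + y%:R :> R by rewrite -natrD ler_nat.
  have {}ba : b%:R <= a%:R + y%:R :> R by rewrite -natrD ler_nat.
  have : y%:R <= (h k)%:R :> R by rewrite ler_nat ltnW.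
  by rewrite ler_norml => yR; apply/andP; split; lra.
suff : `|(visit_count C (iter (P * h k) f z) (M * h k))%:R -
    (M * h k)%:R * pr C| <=
    2 * e * (M * h k)%:R +
    (h k)%:R * (\sum_(j < M) (~~ keeps_type D k n (P + j) + (Q k n <=
      P + j)))%N%:R.
  move: shift_y; rewrite !ler_norml => /andP[? ?] /andP[? ?]; apply/andP;
    split; lra.
rewrite visit_countM !natr_sum mulr_sumr.
have sumM (r : R) : (M * h k)%:R * r = \sum_(j < M) ((h k)%:R * r).
  by rewrite sumr_const card_ord -[RHS]mulr_natl natrM mulrA.
rewrite sumM [2 * e * _]mulrC sumM -sumrB -big_split /=.
apply: le_trans (ler_norm_sum _ _ _) _; apply: ler_sum => j _.
rewrite -iterD -mulnDl addnC.
have he : 0 <= (h k)%:R * (2 * e) by rewrite !mulr_ge0 ?ltW.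
have [gP|/negbTE ngP] := boolP (keeps_type D k n (P + j) && (P + j < Q k n)%N).
  case/andP: gP => gP PQ; have := block_near CL e0 near Lh PQ gP; rewrite -/z.
  move=> H; apply: le_trans H _; rewrite mulrC lerDl mulr_ge0 ?ler0n ?ltW //.
have cle := visit_count_le C (iter ((P + j) * h k) f z) (h k).
have {}cle : (visit_count C (iter ((P + j) * h k) f z) (h k))%:R <=
  (h k)%:R :> R by rewrite ler_nat.
have c0 : 0 <= (visit_count C (iter ((P + j) * h k) f z) (h k))%:R :> R by [].
have ha : (h k)%:R * pr C <= (h k)%:R * 1 by rewrite ler_pM2l.
have ha0 : 0 <= (h k)%:R * pr C by apply: mulr_ge0 => //; apply: ltW.
have : (h k)%:R * 1 <= (h k)%:R * (~~ keeps_type D k n (P + j) + (Q k n <=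
  P + j))%N%:R :> R.
  rewrite ler_pM2l // ler1n; move: ngP; rewrite ltnNge.
  by case: (keeps_type _ _ _ _) => //=; case: (Q k n <= P + j)%N.
by move=> h1; rewrite ler_norml; apply/andP; split; lra.
Qed.

(** Each of the [M] translates meets [bad D k n] changes of type and leaves the large block at no
    more than [M] places. *)
Lemma bad_window_count k n M :
  (\sum_(P < Q k n) \sum_(j < M) (~~ keeps_type D k n (P + j) + (Q k n <=
    P + j)) <=
   M * (bad D k n + M))%N.
Proof.
rewrite exchange_big /= -[leqRHS]sum_ord_const; apply: leq_sum => j _.
rewrite big_split /= keeps_type_shift_count leq_add2l.
have H := sum_interval (Q k n) (Q k n - j) (Q k n).
apply: (@leq_trans j); last exact: ltnW.
apply: leq_trans (_ : Q k n - (Q k n - j) <= j)%N; last by lia.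
rewrite minnn in H; apply: leq_trans H; apply: leq_sum => P _.
have := ltn_ord P; case: leqP => //=; case: leqP; lia.
Qed.

(** Since most windows of [M] blocks have nearly the frequency [pr C] wherever they start,
    restricting the start to [C] does not change the average; this gives the product
    [pr C * pr C]. *)
Lemma generic_mixing_on_average C (e : R) : clopens C -> 0 < e ->
  exists2 N, (0 < N)%N &
    `|\sum_(m < N) pr (return_set m C) - N%:R * pr C ^+ 2| <= e * N%:R.
Proof.
move=> CC e0; have [L CL] := CC; pose e1 := e / 7.
have e1_gt0 : 0 < e1 by rewrite /e1; lra.
have Ee : e = 7 * e1 by rewrite /e1; field.
(* [M] is so large that one block length is at most [e1 * N], which makes the start inside a block
   irrelevant. *)
have [M0 HM0] := eventually_natr e1^-1; pose M := M0.+1.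
have M1 : 1 <= e1 * M%:R.
  by rewrite -ler_pdivrMl // mulr1; apply: HM0; rewrite /M.
have [k0 Hk0] := mu_generic CC e1_gt0.
have [k1 Hk1] := eventually_natr (2 * L%:R / e1).
have [k2 Hk2] := exp8_small e1_gt0.
pose k := maxn k0 (maxn k1 k2).
have near l : `|freq R C k (i, l) - pr C| <= e1 by apply: Hk0; rewrite /k; lia.
have hk := h_gt0R R D k.
have Lh : 2 * L%:R <= e1 * (h k)%:R.
  have : 2 * L%:R / e1 <= (h k)%:R.
    apply: le_trans (Hk1 k _) _; first by rewrite /k; lia.
    by rewrite ler_nat ltnW // ltn_h.
  by rewrite ler_pdivrMr // [e1 * _]mulrC.
have k8 : 4 / 8 ^+ k <= e1.
  apply: le_trans (Hk2 k _); last by rewrite /k; lia.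
  by rewrite ler_wpM2r ?invr_ge0 ?exprn_ge0 // ler_nat.
pose N := (M * h k)%N; exists N; first by rewrite muln_gt0 h_gt0.
have Npos : 0 < N%:R :> R by rewrite ltr0n muln_gt0 h_gt0.
have /choice[kr Hkr] (m : nat) : exists kr, forall K, (kr <= K)%N ->
    `|freq R (return_set m C) K (i, 0) - pr (return_set m C)| <= e1.
  have CR : clopens (return_set m C) by apply: clopensI => //;
    apply: clopens_iter.
  by have [kr Hkr] := mu_generic CR e1_gt0; exists kr => K /Hkr.
have [n0 Hn0] := eventually_natr (M%:R / e1).
pose n := maxn n0 (maxn k0 (\max_(m < N) kr m)); pose K := (k + n)%N.
have kr_le (m : 'I_N) : (kr m <= K)%N.
  have : (kr m <= \max_(m < N) kr m)%N by apply: leq_bigmax.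
  by rewrite /K /n; lia.
have aC : `|freq R C K (i, 0) - pr C| <= e1 by apply: Hk0; rewrite /K /n; lia.
have Qpos : 0 < (Q k n)%:R :> R by rewrite ltr0n Q_gt0.
have MQ : M%:R <= e1 * (Q k n)%:R.
  rewrite [e1 * _]mulrC -ler_pdivrMr //;
    apply: le_trans (Hn0 n (leq_maxl _ _)) _.
  by rewrite ler_nat ltnW // ltn_Q.
have badQ : (bad D k n)%:R <= e1 * (Q k n)%:R.
  have := bad_le_level R D k n.
  have : 4 / 8 ^+ k * (Q k n)%:R <= e1 * (Q k n)%:R by rewrite ler_pM2r.
  have : 0 <= (bad D k n)%:R :> R by [].
  by move: (4 / _ * _) (e1 * _) => u v; lra.
have hK := h_gt0R R D K.
have EK : (h K)%:R = (h k)%:R * (Q k n)%:R :> R by rewrite /K hD natrM.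
have mC := clopen_measurable CC.
have a0 := pr_ge0 mu C; have a1 := pr_le1 mu mC.
pose z := base_point K (i, 0).
(* Five shares: one for the incomplete block, two for the good blocks, two for changes of type and
   overhang. *)
have core : `|(\sum_(m < N) visits (return_set m C) K (i, 0%R))%N%:R -
    (visits C K (i, 0))%:R * (N%:R * pr C)| <= 5 * e1 * N%:R * (h K)%:R.
  rewrite visits_return -/z /visits -/z /visit_count !natr_sum mulr_suml -sumrB.
  apply: le_trans (ler_norm_sum _ _ _) _.
  pose err P : R := (h k)%:R + 2 * e1 * N%:R +
    (h k)%:R * (\sum_(j < M) (~~ keeps_type D k n (P + j) + (Q k n <=
      P + j)))%N%:R.
  have bnd P y : (y < h k)%N ->
      `|(`[< C (iter (P * h k + y) f z) >] * visit_count C (iter (P * h k + y) f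
        z) N)%N%:R -
        `[< C (iter (P * h k + y) f z) >]%:R * (N%:R * pr C)| <= err P.
    move=> yh; have := @window_average C e1 L k n M P y CL e1_gt0 near Lh yh.
    rewrite -/K -/z -/N -/(err P) => H.
    rewrite natrM -mulrBr normrM; case: asboolP => _;
      first by rewrite normr1 mul1r.
    by rewrite normr0 mul0r; apply: le_trans H.
  have -> : h K = (Q k n * h k)%N by rewrite /K hD mulnC.
  rewrite (big_ord_mul _ _ _ (fun p => `|(`[< C (iter p f z) >] *
    \sum_(n1 < N) `[< C (iter n1 f (iter p f z)) >])%N%:R -
        `[< C (iter p f z) >]%:R * (N%:R * pr C)|)).
  apply: (@le_trans _ _ (\sum_(P < Q k n) (h k)%:R * err P)).
    apply: ler_sum => P _.
    have -> : (h k)%:R * err P = \sum_(y < h k) err P.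
      by rewrite sumr_const card_ord mulr_natl.
    by apply: ler_sum => y _; apply: bnd.
  rewrite -mulr_sumr big_split /= sumr_const card_ord -[_ *+ Q k n]mulr_natl.
  rewrite -mulr_sumr -natr_sum.
  have := bad_window_count k n M; set B := (\sum_(P < Q k n) _)%N => HB.
  have {}HB : B%:R <= M%:R * ((bad D k n)%:R + M%:R) :> R.
    by rewrite -natrD -natrM ler_nat.
  have hB : (h k)%:R * B%:R <= (h k)%:R * (M%:R * (2 * e1 * (Q k n)%:R)).
    rewrite ler_pM2l //; apply: le_trans HB _; rewrite ler_wpM2l // -mulrA; lra.
  have hh : (Q k n)%:R * (h k)%:R <= (Q k n)%:R * (e1 * N%:R).
    rewrite ler_pM2l // /N natrM mulrA -{1}[(h k)%:R]mul1r ler_pM2r //.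
  rewrite natrM.
  have -> : 5 * e1 * N%:R * ((Q k n)%:R * (h k)%:R) = (h k)%:R *
    ((Q k n)%:R * (e1 * N%:R) + (Q k n)%:R * (2 * e1 * N%:R) +
      (h k)%:R * (M%:R * (2 * e1 * (Q k n)%:R))).
    by rewrite /N natrM; ring.
  by rewrite ler_pM2l // mulrDr; lra.
have core' : `|\sum_(m < N) freq R (return_set m C) K (i, 0) -
    freq R C K (i, 0) * (N%:R * pr C)| <= 5 * e1 * N%:R.
  rewrite /freq -mulr_suml -natr_sum mulrAC -mulrBl normrM normfV.
  by rewrite (gtr0_norm hK) ler_pdivrMr.
have hret : `|\sum_(m < N) pr (return_set m C) -
    \sum_(m < N) freq R (return_set m C) K (i, 0)| <= e1 * N%:R.
  rewrite -sumrB; apply: le_trans (ler_norm_sum _ _ _) _.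
  have -> : e1 * N%:R = \sum_(m < N) e1 by rewrite sumr_const card_ord
    mulr_natr.
  by apply: ler_sum => m _; rewrite distrC; apply: Hkr.
have hC : `|freq R C K (i, 0) * (N%:R * pr C) - N%:R * pr C ^+ 2| <= e1 * N%:R.
  have -> : freq R C K (i, 0) * (N%:R * pr C) - N%:R * pr C ^+ 2 =
    (freq R C K (i, 0) - pr C) * (N%:R * pr C) by ring.
  rewrite normrM; apply: ler_pM => //.
  by rewrite ger0_norm ?mulr_ge0 // -[leRHS]mulr1 ler_pM2l.
rewrite Ee; move: hret core' hC; rewrite !ler_norml.
move=> /andP[? ?] /andP[? ?] /andP[? ?]; apply/andP; split; lra.
Qed.

End Ergodicity.

Theorem theorem1p1 (R : realType) (d : nat) (hd : (2 <= d)%N) :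
  exists (A : finType) (X : subshift A),
    [/\ minimal (@subshift_map A X),
        ~ superlinear_complexity R X &
        exists mu : 'I_d -> probability (borel X) R,
          let rate i := partial_rigidity_rate (mu i) (@subshift_map A X) in
          [/\ injective mu,
              forall i, ergodic (mu i) (@subshift_map A X),
              forall i, 0 < rate i < 1,
              forall i j : 'I_d, (i < j)%N -> rate i < rate j &
              exists n : nat -> nat, forall i,
                partially_rigid_along (mu i) (@subshift_map A X) (rate i) n]].
Proof.
case: d hd => // D _.
exists (state D), (block_subshift D); split.
- exact: block_subshift_minimal.
- exact: block_subshift_complexity.
have /choice[mu Hmu] := @exists_generic R D.
exists mu => rate.
have h_inc : {homo h D : k l / (k < l)%N >-> (k < l)%N}.
  by move=> k l; rewrite (leqW_mono (leq_h D)).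
have run8 (i : 'I_D.+1) : 8 <= (run i)%:R :> R by rewrite ler_nat leq_8_run.
have val_gt0 (i : 'I_D.+1) : 0 < rate_value R i.
  rewrite subr_gt0 invf_lt1; have := run8 i; lra.
(* The heights [h k] do not depend on the type, so one sequence serves all the measures. *)
have val_rigid i : partially_rigid_along (mu i)
    (@subshift_map _ (block_subshift D)) (rate_value R i) (h D).
  apply: rigid_of_clopens => //; [exact: generic_invariant|exact: ltW|].
  by move=> C e CC e0; apply: generic_rigid.
have rateE i : rate i = rate_value R i.
  apply: (@partial_rigidity_rateE _ _ _ _ _ (h D)) => // e e0.
  exact: generic_match.
have rate_lt (i j : 'I_D.+1) : (i < j)%N -> rate i < rate j.
  move=> ij; rewrite !rateE ltrD2l ltrN2 ltf_pV2 ?posrE ?run_gt0R //.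
  by rewrite ltr_nat ltn_exp2l.
split=> //.
- move=> i j Eij; apply/val_inj; case: (ltngtP (val i) (val j)) => // /rate_lt.
    by rewrite /rate Eij ltxx.
  by rewrite /rate Eij ltxx.
- move=> i; apply: ergodic_of_clopens; first exact: generic_invariant.
  by move=> C e CC e0; apply: generic_mixing_on_average.
- move=> i; rewrite rateE val_gt0 /= ltrBlDr ltrDl invr_gt0; exact: run_gt0R.
- by exists (h D) => i; rewrite rateE.
Qed.
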